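(* The first-order theory $T$ of join semilattices with a closure operation has a model completion. In more detail, if $\mathbf M$ is the Fraïssé limit of the class of finite join semilattices with a closure operation, then the first-order theory $Th(\mathbf M)$ is $\omega$-categorical, has quantifier elimination and is the model completion of $T$. Dually, the first-order theory $T'$ of meet semilattices with an interior operation has a model completion; in more detail, if $\mathbf M'$ is the Fraïssé limit of the class of finite meet semilattices with an interior operation, then the first-order theory $Th(\mathbf M')$ is $\omega$-categorical, has quantifier elimination and is the model completion of $T'$.
   Context: A closure (interior) operation on a poset is a unary operation $K$ which is extensive: $x\le Kx$ (contractive: $Kx\le x$), isotone ($x\le y$ implies $Kx\le Ky$) and idempotent ($KKx=Kx$); no additivity or multiplicativity is assumed. The language consists of the semilattice operation and $K$, and $\le$ is the semilattice order ($x\le y$ iff $x\vee y=y$ for join semilattices, iff $x\wedge y=x$ for meet semilattices). A Fraïssé limit of a class $\mathcal H$ of finitely generated structures is a countable universal homogeneous structure of age $\mathcal H$. A theory $T$ has a model companion if $T$ has the same universal consequences as some model complete theory $T^*$; if in addition $T$ has the amalgamation property, $T^*$ is a model completion of $T$. *)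

(* Defs.v *)
From Stdlib Require Export List FinFun.
From Stdlib Require Import Arith.
Export ListNotations.

(* The same symbol [op] is read as join or as meet, and [cl] as a closure or
   as an interior operation.  As usual in first-order logic, the universe of
   a structure is nonempty. *)
Record structure : Type := Structure {
  carrier :> Type;
  op : carrier -> carrier -> carrier;
  cl : carrier -> carrier;
  carrier_inhabited : inhabited carrier
}.
Arguments op {_} _ _.
Arguments cl {_} _.

Definition is_embedding (A B : structure) (f : A -> B) : Prop :=
  Injective f /\
  (forall x y, f (op x y) = op (f x) (f y)) /\
  (forall x, f (cl x) = cl (f x)).
Arguments is_embedding {A B} f.

Definition embeds (A B : structure) : Prop :=
  exists f : A -> B, is_embedding f.

Definition is_isomorphism (A B : structure) (f : A -> B) : Prop :=
  is_embedding f /\ Bijective f.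
Arguments is_isomorphism {A B} f.

Definition isomorphic (A B : structure) : Prop :=
  exists f : A -> B, is_isomorphism f.

Record substructure (M : structure) : Type := Substructure {
  dom : M -> Prop;
  dom_nonempty : exists x, dom x;
  dom_op : forall x y, dom x -> dom y -> dom (op x y);
  dom_cl : forall x, dom x -> dom (cl x)
}.
Arguments dom {M} _ _.
Arguments dom_nonempty {M} _.
Arguments dom_op {M} _ {x y} _ _.
Arguments dom_cl {M} _ {x} _.

Definition induced (M : structure) (S : substructure M) : structure := {|
  carrier := {x : M | dom S x};
  op := fun x y =>
    exist _ (op (proj1_sig x) (proj1_sig y))
            (dom_op S (proj2_sig x) (proj2_sig y));
  cl := fun x => exist _ (cl (proj1_sig x)) (dom_cl S (proj2_sig x));
  carrier_inhabited :=
    let (x, Hx) := dom_nonempty S in inhabits (exist _ x Hx)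
|}.
Arguments induced {M} S.

Inductive generated (A : structure) (X : A -> Prop) : A -> Prop :=
| gen_base x : X x -> generated A X x
| gen_op x y : generated A X x -> generated A X y -> generated A X (op x y)
| gen_cl x : generated A X x -> generated A X (cl x).

Definition finitely_generated (A : structure) : Prop :=
  exists l : list A, forall x : A, generated A (fun y => In y l) x.

Definition countable (A : structure) : Prop :=
  exists f : A -> nat, Injective f.

Definition countably_infinite (A : structure) : Prop :=
  exists f : A -> nat, Bijective f.

Definition age (M A : structure) : Prop :=
  finitely_generated A /\ embeds A M.

Definition homogeneous (M : structure) : Prop :=
  forall S1 S2 : substructure M,
    finitely_generated (induced S1) -> finitely_generated (induced S2) ->
    forall f : induced S1 -> induced S2, is_isomorphism f ->
    exists g : M -> M, is_isomorphism g /\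
      forall x : induced S1, g (proj1_sig x) = proj1_sig (f x).

(* "Universal" is the left-to-right half of the last clause: every member of
   [H] embeds into [M]. *)
Definition is_Fraisse_limit (H : structure -> Prop) (M : structure) : Prop :=
  countable M /\ homogeneous M /\ forall A, H A <-> age M A.

Inductive term : Type :=
| Var (n : nat)
| Op (s t : term)
| Cl (t : term).

(* The remaining connectives and the existential quantifier are definable,
   logic being classical. *)
Inductive formula : Type :=
| Bot
| Eq (s t : term)
| Imp (phi psi : formula)
| All (n : nat) (phi : formula).

Fixpoint eval (A : structure) (v : nat -> A) (t : term) : A :=
  match t with
  | Var n => v n
  | Op s t => op (eval A v s) (eval A v t)
  | Cl t => cl (eval A v t)
  end.

Definition update {X : Type} (v : nat -> X) (n : nat) (a : X) : nat -> X :=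
  fun m => if Nat.eqb m n then a else v m.

Fixpoint sat (A : structure) (v : nat -> A) (phi : formula) : Prop :=
  match phi with
  | Bot => False
  | Eq s t => eval A v s = eval A v t
  | Imp phi psi => sat A v phi -> sat A v psi
  | All n phi => forall a : A, sat A (update v n a) phi
  end.

Fixpoint occurs (n : nat) (t : term) : Prop :=
  match t with
  | Var m => m = n
  | Op s t => occurs n s \/ occurs n t
  | Cl t => occurs n t
  end.

Fixpoint free (n : nat) (phi : formula) : Prop :=
  match phi with
  | Bot => False
  | Eq s t => occurs n s \/ occurs n t
  | Imp phi psi => free n phi \/ free n psi
  | All m phi => m <> n /\ free n phi
  end.

Definition sentence (phi : formula) : Prop := forall n, ~ free n phi.

Fixpoint quantifier_free (phi : formula) : Prop :=
  match phi with
  | Bot | Eq _ _ => True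
  | Imp phi psi => quantifier_free phi /\ quantifier_free psi
  | All _ _ => False
  end.

Inductive universal : formula -> Prop :=
| universal_qf phi : quantifier_free phi -> universal phi
| universal_All n phi : universal phi -> universal (All n phi).

Definition valid_in (A : structure) (phi : formula) : Prop :=
  forall v, sat A v phi.

Definition is_theory (T : formula -> Prop) : Prop :=
  forall phi, T phi -> sentence phi.

Definition is_model (T : formula -> Prop) (A : structure) : Prop :=
  forall phi, T phi -> valid_in A phi.

Definition entails (T : formula -> Prop) (phi : formula) : Prop :=
  forall A, is_model T A -> valid_in A phi.

Definition Th (M : structure) : formula -> Prop :=
  fun phi => sentence phi /\ valid_in M phi.

Definition is_elementary (A B : structure) (f : A -> B) : Prop :=
  forall phi (v : nat -> A), sat A v phi <-> sat B (fun n => f (v n)) phi.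
Arguments is_elementary {A B} f.

Definition omega_categorical (T : formula -> Prop) : Prop :=
  (exists A, is_model T A /\ countably_infinite A) /\
  (forall A B, is_model T A -> countably_infinite A ->
               is_model T B -> countably_infinite B -> isomorphic A B).

Definition has_quantifier_elimination (T : formula -> Prop) : Prop :=
  forall phi, exists psi,
    quantifier_free psi /\
    (forall n, free n psi -> free n phi) /\
    entails T (Imp phi psi) /\ entails T (Imp psi phi).

Definition model_complete (T : formula -> Prop) : Prop :=
  forall (A B : structure) (f : A -> B),
    is_model T A -> is_model T B -> is_embedding f -> is_elementary f.

Definition same_universal_consequences (T T' : formula -> Prop) : Prop :=
  forall phi, sentence phi -> universal phi -> (entails T phi <-> entails T' phi).

Definition is_model_companion (T T' : formula -> Prop) : Prop :=
  is_theory T' /\ model_complete T' /\ same_universal_consequences T T'.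

Definition amalgamation_property (T : formula -> Prop) : Prop :=
  forall (A B C : structure) (f : A -> B) (g : A -> C),
    is_model T A -> is_model T B -> is_model T C ->
    is_embedding f -> is_embedding g ->
    exists (D : structure) (f' : B -> D) (g' : C -> D),
      is_model T D /\ is_embedding f' /\ is_embedding g' /\
      forall a, f' (f a) = g' (g a).

Definition is_model_completion (T T' : formula -> Prop) : Prop :=
  is_model_companion T T' /\ amalgamation_property T.

Definition has_model_completion (T : formula -> Prop) : Prop :=
  exists T', is_model_completion T T'.

Definition is_semilattice (A : structure) : Prop :=
  (forall x y z : A, op x (op y z) = op (op x y) z) /\
  (forall x y : A, op x y = op y x) /\
  (forall x : A, op x x = x).

Definition join_le (A : structure) (x y : A) : Prop := op x y = y.
Definition meet_le (A : structure) (x y : A) : Prop := op x y = x.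

Definition is_closure {X : Type} (le : X -> X -> Prop) (K : X -> X) : Prop :=
  (forall x, le x (K x)) /\
  (forall x y, le x y -> le (K x) (K y)) /\
  (forall x, K (K x) = K x).

Definition is_interior {X : Type} (le : X -> X -> Prop) (K : X -> X) : Prop :=
  (forall x, le (K x) x) /\
  (forall x y, le x y -> le (K x) (K y)) /\
  (forall x, K (K x) = K x).

Definition join_semilattice_with_closure (A : structure) : Prop :=
  is_semilattice A /\ is_closure (join_le A) cl.

Definition meet_semilattice_with_interior (A : structure) : Prop :=
  is_semilattice A /\ is_interior (meet_le A) cl.

Definition finite_join_semilattice_with_closure (A : structure) : Prop :=
  Finite A /\ join_semilattice_with_closure A.

Definition finite_meet_semilattice_with_interior (A : structure) : Prop :=
  Finite A /\ meet_semilattice_with_interior A.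

Definition semilattice_axioms : list formula :=
  [ All 0 (All 1 (All 2
      (Eq (Op (Var 0) (Op (Var 1) (Var 2))) (Op (Op (Var 0) (Var 1)) (Var 2)))));
    All 0 (All 1 (Eq (Op (Var 0) (Var 1)) (Op (Var 1) (Var 0))));
    All 0 (Eq (Op (Var 0) (Var 0)) (Var 0)) ].

Definition join_Le (s t : term) : formula := Eq (Op s t) t.
Definition meet_Le (s t : term) : formula := Eq (Op s t) s.

Definition closure_axioms : list formula :=
  [ All 0 (join_Le (Var 0) (Cl (Var 0)));
    All 0 (All 1 (Imp (join_Le (Var 0) (Var 1))
                      (join_Le (Cl (Var 0)) (Cl (Var 1)))));
    All 0 (Eq (Cl (Cl (Var 0))) (Cl (Var 0))) ].

Definition interior_axioms : list formula :=
  [ All 0 (meet_Le (Cl (Var 0)) (Var 0));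
    All 0 (All 1 (Imp (meet_Le (Var 0) (Var 1))
                      (meet_Le (Cl (Var 0)) (Cl (Var 1)))));
    All 0 (Eq (Cl (Cl (Var 0))) (Cl (Var 0))) ].

Definition T_join_closure : formula -> Prop :=
  fun phi => In phi (semilattice_axioms ++ closure_axioms).

Definition T_meet_interior : formula -> Prop :=
  fun phi => In phi (semilattice_axioms ++ interior_axioms).

Lemma T_join_closure_is_theory : is_theory T_join_closure.
Proof.
  unfold is_theory, T_join_closure, sentence; simpl; intros phi H n.
  repeat destruct H as [<- | H]; simpl; intuition congruence.
Qed.

Lemma T_meet_interior_is_theory : is_theory T_meet_interior.
Proof.
  unfold is_theory, T_meet_interior, sentence; simpl; intros phi H n.
  repeat destruct H as [<- | H]; simpl; intuition congruence.
Qed.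

Lemma is_model_T_join_closure (A : structure) :
  is_model T_join_closure A <-> join_semilattice_with_closure A.
Proof.
  destruct (carrier_inhabited A) as [a].
  unfold is_model, T_join_closure, valid_in; split.
  - intros H.
    repeat split; unfold join_le; intros.
    + exact (H _ (or_introl eq_refl) (fun _ => a) x y z).
    + exact (H _ (or_intror (or_introl eq_refl)) (fun _ => a) x y).
    + exact (H _ (or_intror (or_intror (or_introl eq_refl))) (fun _ => a) x).
    + refine (H (nth 0 closure_axioms Bot) _ (fun _ => a) x); simpl; tauto.
    + refine (H (nth 1 closure_axioms Bot) _ (fun _ => a) x y _); simpl; tauto.
    + refine (H (nth 2 closure_axioms Bot) _ (fun _ => a) x); simpl; tauto.
  - intros [(As & Co & Id) (Ex & Is & Ie)] phi H v; simpl in H.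
    repeat destruct H as [<- | H]; simpl; unfold update; simpl; intros;
      unfold join_le, meet_le in *; auto; contradiction.
Qed.

Lemma is_model_T_meet_interior (A : structure) :
  is_model T_meet_interior A <-> meet_semilattice_with_interior A.
Proof.
  destruct (carrier_inhabited A) as [a].
  unfold is_model, T_meet_interior, valid_in; split.
  - intros H.
    repeat split; unfold meet_le; intros.
    + exact (H _ (or_introl eq_refl) (fun _ => a) x y z).
    + exact (H _ (or_intror (or_introl eq_refl)) (fun _ => a) x y).
    + exact (H _ (or_intror (or_intror (or_introl eq_refl))) (fun _ => a) x).
    + refine (H (nth 0 interior_axioms Bot) _ (fun _ => a) x); simpl; tauto.
    + refine (H (nth 1 interior_axioms Bot) _ (fun _ => a) x y _); simpl; tauto.
    + refine (H (nth 2 interior_axioms Bot) _ (fun _ => a) x); simpl; tauto.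
  - intros [(As & Co & Id) (Ex & Is & Ie)] phi H v; simpl in H.
    repeat destruct H as [<- | H]; simpl; unfold update; simpl; intros;
      unfold join_le, meet_le in *; auto; contradiction.
Qed.

(* Main.v *)
From Stdlib Require Import Arith Lia Classical ClassicalEpsilon.
From Stdlib Require Import FunctionalExtensionality PropExtensionality ProofIrrelevance.
Require Import Defs.

(** Reversing the order turns a meet semilattice with an interior operation
    into a join semilattice with a closure operation; since the language does
    not contain the order, the two classes of structures are the same, and only
    the join case needs an argument.

    The class is locally finite: the identity [cl (op x (cl y)) = cl (op x y)]
    makes every term equal to a join of variables and of closures of joins of
    variables ([normal_form]).  It has amalgamation: glue two models along a
    common submodel into a preorder that carries the operations partially, and
    take its lattice of ideals, where the closure of an ideal is the least ideal
    above it that is stable under the partial closure ([completion]).  The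
    principal ideals then form the glued copy ([gluing]).

    The central notion is that of a [rich] model, one which realises every
    one-point extension of a finitely generated submodel.  Homogeneity and
    universality make the Fraïssé limit rich ([fraisse_rich]).  In a rich model
    the quantifier-free type of a tuple determines which formulas hold of it
    ([rich_homogeneous]), and by local finiteness there are finitely many such
    types, each isolated by a formula.  So its theory has quantifier
    elimination, hence is model complete.  A universal sentence that fails in
    some model fails in a finitely generated submodel, whose generators a rich
    model can copy one by one, so the universal consequences are those of the
    class ([rich_universal]).  Quantifier elimination also carries the extension
    property over to any pair of models of the theory ([Th_extension]), and the
    back-and-forth construction gives categoricity.

    That some model companion exists at all amounts to the existence of a rich
    model, countable or not.  Gluing all extension problems over a model [N] to
    [N] simultaneously solves them in one step ([one_step_extension]), and
    iterating along a chain of length omega gives a rich colimit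
    ([rich_model_exists]). *)

Local Notation model := join_semilattice_with_closure.

Definition is_hom (A B : structure) (f : A -> B) : Prop :=
  (forall x y, f (op x y) = op (f x) (f y)) /\ (forall x, f (cl x) = cl (f x)).
Arguments is_hom {A B} f.

(** * Terms, valuations and quantifier-free types *)

Definition over (F : list nat) (t : term) : Prop := forall n, occurs n t -> In n F.

(** Equality of the quantifier-free types of two tuples, both indexed by the
    variables in [F]. *)
Definition same_type (A B : structure) (F : list nat) (v : nat -> A) (w : nat -> B) : Prop :=
  forall s t, over F s -> over F t ->
    (eval A v s = eval A v t <-> eval B w s = eval B w t).
Arguments same_type {A B} F v w.

Lemma eval_agree (A : structure) (v w : nat -> A) t :
  (forall n, occurs n t -> v n = w n) -> eval A v t = eval A w t.
Proof.
  induction t; simpl; intros H.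
  - apply H; reflexivity.
  - rewrite IHt1, IHt2; auto.
  - rewrite IHt; auto.
Qed.

Lemma eval_hom (A B : structure) (f : A -> B) v t :
  is_hom f -> f (eval A v t) = eval B (fun n => f (v n)) t.
Proof.
  intros [Hop Hcl]; induction t; simpl; auto.
  - rewrite Hop, IHt1, IHt2; reflexivity.
  - rewrite Hcl, IHt; reflexivity.
Qed.

Fixpoint rename (r : nat -> nat) (t : term) : term :=
  match t with
  | Var n => Var (r n)
  | Op s t => Op (rename r s) (rename r t)
  | Cl t => Cl (rename r t)
  end.

Lemma eval_rename (A : structure) (v : nat -> A) r t :
  eval A v (rename r t) = eval A (fun n => v (r n)) t.
Proof. induction t; simpl; congruence. Qed.

Lemma over_rename F r t : (forall n, In (r n) F) -> over F (rename r t).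
Proof.
  intros H; induction t; intros m; simpl.
  - intros <-; apply H.
  - intros [Hm | Hm]; [apply (IHt1 m Hm) | apply (IHt2 m Hm)].
  - apply IHt.
Qed.

Lemma embedding_hom (A B : structure) (f : A -> B) : is_embedding f -> is_hom f.
Proof. intros [_ H]; exact H. Qed.

Lemma same_type_sym (A B : structure) F (v : nat -> A) (w : nat -> B) :
  same_type F v w -> same_type F w v.
Proof. intros H s t Hs Ht; symmetry; apply H; assumption. Qed.

Lemma same_type_trans (A B C : structure) F (v : nat -> A) (w : nat -> B) (u : nat -> C) :
  same_type F v w -> same_type F w u -> same_type F v u.
Proof. intros H H' s t Hs Ht; rewrite (H s t Hs Ht); apply H'; assumption. Qed.

Lemma same_type_incl (A B : structure) F F' (v : nat -> A) (w : nat -> B) :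
  incl F' F -> same_type F v w -> same_type F' v w.
Proof. intros HF H s t Hs Ht; apply H; intros n Hn; auto. Qed.

Lemma same_type_agree (A : structure) F (v w : nat -> A) :
  (forall n, In n F -> v n = w n) -> same_type F v w.
Proof.
  intros H s t Hs Ht.
  rewrite (eval_agree A v w s), (eval_agree A v w t) by auto; tauto.
Qed.

Lemma same_type_embedding (A B : structure) (f : A -> B) F v :
  is_embedding f -> same_type F v (fun n => f (v n)).
Proof.
  intros Hf s t _ _.
  rewrite <- !(eval_hom A B f) by apply (embedding_hom _ _ _ Hf).
  split; [congruence | apply (proj1 Hf)].
Qed.

Lemma update_same {X : Type} (v : nat -> X) n a : update v n a n = a.
Proof. unfold update; rewrite Nat.eqb_refl; reflexivity. Qed.

Lemma update_other {X : Type} (v : nat -> X) n m a : m <> n -> update v n a m = v m.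
Proof. intros H; unfold update; rewrite (proj2 (Nat.eqb_neq m n) H); reflexivity. Qed.

Lemma update_id {X : Type} (v : nat -> X) n : update v n (v n) = v.
Proof.
  apply functional_extensionality; intros m; unfold update.
  destruct (Nat.eqb_spec m n); congruence.
Qed.

Lemma update_comp {X Y : Type} (f : X -> Y) (v : nat -> X) n a :
  (fun m => f (update v n a m)) = update (fun m => f (v m)) n (f a).
Proof.
  apply functional_extensionality; intros m; unfold update.
  destruct (Nat.eqb m n); reflexivity.
Qed.

(** * Closure preorders and their completion by ideals *)

(** A preorder in which [J x y z] makes [z] a least upper bound of [x] and [y],
    and [C x y] makes [y] the least closed element above [x].  Both operations
    are relations because the preorders glued below carry them only partially. *)
Record closure_preorder (Y : Type) (le : Y -> Y -> Prop)
    (J : Y -> Y -> Y -> Prop) (C : Y -> Y -> Prop) : Prop := {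
  cp_refl : forall x, le x x;
  cp_trans : forall x y z, le x y -> le y z -> le x z;
  cp_ub_l : forall x y z, J x y z -> le x z;
  cp_ub_r : forall x y z, J x y z -> le y z;
  cp_lub : forall x y z u, J x y z -> le x u -> le y u -> le z u;
  cp_ext : forall x x', C x x' -> le x x';
  cp_least : forall x x' y y', C x x' -> C y y' -> le x y' -> le x' y'
}.
Arguments closure_preorder {Y} le J C.

Definition total_preorder (A : structure) (le : A -> A -> Prop) : Prop :=
  closure_preorder le (fun x y z => z = op x y) (fun x x' => x' = cl x).

Lemma model_total_preorder (A : structure) :
  model A -> total_preorder A (join_le A).
Proof.
  intros ((As & Co & Id) & (Ex & Is & Ie)); unfold join_le in *.
  split; intros; subst; auto.
  - rewrite <- H0, As, H; reflexivity.
  - rewrite As, Id; reflexivity.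
  - rewrite (Co x), As, Id; reflexivity.
  - rewrite <- As, H1; exact H0.
  - rewrite <- (Ie y); apply Is; assumption.
Qed.

Lemma join_le_antisym (A : structure) (x y : A) :
  model A -> join_le A x y -> join_le A y x -> x = y.
Proof. unfold join_le; intros ((_ & Co & _) & _) H H'; rewrite <- H, Co; auto. Qed.

Lemma antisymmetric_total_preorder_model (A : structure) (le : A -> A -> Prop) :
  total_preorder A le -> (forall x y, le x y -> le y x -> x = y) ->
  model A /\ forall x y, join_le A x y <-> le x y.
Proof.
  intros [R T Ul Ur Lub Ex Le] As.
  assert (Hl : forall x y : A, le x (op x y)) by (intros; eapply Ul; reflexivity).
  assert (Hr : forall x y : A, le y (op x y)) by (intros; eapply Ur; reflexivity).
  assert (Hlub : forall x y u : A, le x u -> le y u -> le (op x y) u)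
    by (intros; eapply Lub; eauto).
  assert (Hle : forall x y, join_le A x y <-> le x y).
  { intros x y; unfold join_le; split; intros H.
    - rewrite <- H; apply Hl.
    - apply As; auto. }
  split; [| exact Hle].
  split; [split; [| split] | split; [| split]].
  - intros x y z; apply As; repeat apply Hlub; eauto.
  - intros x y; apply As; auto.
  - intros x; apply As; auto.
  - intros x; apply Hle; eapply Ex; reflexivity.
  - intros x y H; apply Hle; apply Hle in H.
    eapply Le; [reflexivity | reflexivity |].
    apply (T x y); [exact H | eapply Ex; reflexivity].
  - intros x; apply As.
    + eapply Le; [reflexivity | reflexivity | apply R].
    + eapply Ex; reflexivity.
Qed.

Section Completion.

Context {Y : Type} (le : Y -> Y -> Prop)
  (J : Y -> Y -> Y -> Prop) (C : Y -> Y -> Prop).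

Definition ideal (I : Y -> Prop) : Prop :=
  (forall x y, le x y -> I y -> I x) /\ (forall x y z, J x y z -> I x -> I y -> I z).

Definition closed (I : Y -> Prop) : Prop := forall x x', C x x' -> I x -> I x'.

Definition meet_of (Q : (Y -> Prop) -> Prop) (y : Y) : Prop :=
  forall I, ideal I -> Q I -> I y.

Lemma ideal_meet_of Q : ideal (meet_of Q).
Proof.
  split.
  - intros x y Hxy Hy I HI HQ; apply (proj1 HI x y Hxy), Hy; assumption.
  - intros x y z HJ Hx Hy I HI HQ.
    apply (proj2 HI x y z HJ); [apply Hx | apply Hy]; assumption.
Qed.

Definition ideals : structure := {|
  carrier := {I : Y -> Prop | ideal I};
  op := fun I I' =>
    exist _ _ (ideal_meet_of (fun K =>
      forall y, proj1_sig I y \/ proj1_sig I' y -> K y));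
  cl := fun I =>
    exist _ _ (ideal_meet_of (fun K =>
      closed K /\ forall y, proj1_sig I y -> K y));
  carrier_inhabited := inhabits (exist _ _ (ideal_meet_of (fun _ => True)))
|}.

Definition ideal_le (I I' : ideals) : Prop :=
  forall y, proj1_sig I y -> proj1_sig I' y.

Lemma ideals_model :
  model ideals /\ forall I I', join_le ideals I I' <-> ideal_le I I'.
Proof.
  apply antisymmetric_total_preorder_model; [split |].
  - intros I y; auto.
  - intros I1 I2 I3 H H' y Hy; auto.
  - intros I1 I2 I3 -> y Hy K HK HQ; apply HQ; auto.
  - intros I1 I2 I3 -> y Hy K HK HQ; apply HQ; auto.
  - intros I1 I2 I3 U -> H1 H2 y Hy; apply Hy; [apply (proj2_sig U) |].
    intros z [Hz | Hz]; auto.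
  - intros I I' -> y Hy K HK HQ; apply HQ, Hy.
  - intros I I' L L' -> -> H y Hy K HK HQ.
    apply Hy; [exact HK | split; [apply HQ |]].
    intros z Hz; apply (H z Hz); assumption.
  - intros [I HI] [I' HI'] H H'.
    apply subset_eq_compat, functional_extensionality; intros y.
    apply propositional_extensionality; split; [apply H | apply H'].
Qed.

(** The principal ideals form a copy of the preorder, and the operations that
    exist in it are computed there: an ideal containing [x] and [y] contains
    their join, and the principal ideal of a closed element is closed. *)
Lemma completion :
  closure_preorder le J C ->
  exists (D : structure) (i : Y -> D),
    model D /\
    (forall x y, join_le D (i x) (i y) <-> le x y) /\
    (forall x y z, J x y z -> i z = op (i x) (i y)) /\
    (forall x x', C x x' -> i x' = cl (i x)).
Proof.
  intros [R T Ul Ur Lub Ex Le].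
  destruct ideals_model as [HD Hle].
  assert (Hid : forall y, ideal (fun x => le x y)).
  { intros y; split; eauto. }
  exists ideals, (fun y => exist _ _ (Hid y)).
  assert (Hprinc : forall (y : Y) (I : ideals),
    proj1_sig I y -> ideal_le (exist _ _ (Hid y)) I).
  { intros y I Hy x Hx; apply (proj1 (proj2_sig I) x y Hx Hy). }
  split; [exact HD | split; [| split]].
  - intros x y; rewrite Hle; split.
    + intros H; apply (H x), R.
    + intros H; apply Hprinc, H.
  - intros x y z HJ; apply join_le_antisym; [exact HD | |]; apply Hle.
    + apply Hprinc; intros K HK HQ; apply (proj2 HK x y z HJ); apply HQ; simpl; auto.
    + intros u Hu; apply Hu; [apply Hid |].
      intros k [Hk | Hk]; simpl in Hk; [apply (T _ x) | apply (T _ y)]; eauto.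
  - intros x x' HC; apply join_le_antisym; [exact HD | |]; apply Hle.
    + apply Hprinc; intros K HK [HK' HQ]; apply (HK' x x' HC), HQ; simpl; auto.
    + intros u Hu; apply Hu; [apply Hid | split].
      * intros k k' Hk Hk'; apply (Le k k' x x'); assumption.
      * intros k Hk; apply (T _ x); [exact Hk | apply (Ex _ _ HC)].
Qed.

End Completion.

Lemma embedded_model (A B : structure) (f : A -> B) :
  is_embedding f -> model B -> model A.
Proof.
  intros (Hi & Hop & Hcl) ((As & Co & Id) & (Ex & Is & Ie)); unfold join_le in *.
  split; [split; [| split] | split; [| split]]; unfold join_le; intros;
    apply Hi; rewrite ?Hop, ?Hcl, ?Hop, ?Hcl; auto.
  apply Is; rewrite <- Hop, H; reflexivity.
Qed.

Lemma induced_embedding (A : structure) (S : substructure A) :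
  is_embedding (A := induced S) (B := A) (@proj1_sig _ _).
Proof.
  split; [| split; reflexivity].
  intros [x Hx] [y Hy] H; apply subset_eq_compat; exact H.
Qed.

(** The quotient of [X] by the equivalence of [le], realised as the principal
    ideals inside the completion. *)
Lemma quotient (X : structure) (le : X -> X -> Prop) :
  total_preorder X le ->
  exists (Q : structure) (p : X -> Q),
    model Q /\ is_hom p /\ (forall q, exists x, p x = q) /\
    (forall x y, join_le Q (p x) (p y) <-> le x y).
Proof.
  intros Hle; destruct (completion _ _ _ Hle) as (D & i & HD & Hi & Hop & Hcl).
  destruct (carrier_inhabited X) as [x0].
  assert (Hdop : forall d d' : D, (exists x, i x = d) -> (exists x, i x = d') ->
    exists x, i x = op d d').
  { intros d d' [x <-] [x' <-]; exists (op x x'); apply Hop; reflexivity. }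
  assert (Hdcl : forall d : D, (exists x, i x = d) -> exists x, i x = cl d).
  { intros d [x <-]; exists (cl x); apply Hcl; reflexivity. }
  pose (S := Substructure D (fun d => exists x, i x = d)
    (ex_intro _ (i x0) (ex_intro _ x0 eq_refl)) Hdop Hdcl).
  exists (induced S), (fun x => exist _ (i x) (ex_intro _ x eq_refl)).
  split; [exact (embedded_model _ _ _ (induced_embedding D S) HD) | split; [split | split]].
  - intros x y; apply subset_eq_compat, Hop; reflexivity.
  - intros x; apply subset_eq_compat, Hcl; reflexivity.
  - intros [d [x Hx]]; exists x; apply subset_eq_compat, Hx.
  - intros x y; rewrite <- Hi; unfold join_le; split; intros H.
    + exact (f_equal (@proj1_sig _ _) H).
    + apply subset_eq_compat, H.
Qed.

(** * Gluing and amalgamation *)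

Section Gluing.

Context (H X : structure) (I : Type) (le : I -> X -> X -> Prop) (E : I -> H -> X -> Prop).
Hypothesis (HH : model H).
Hypothesis (Hle : forall i, total_preorder X (le i)).
Hypothesis (E_le : forall i h h' x x',
  E i h x -> E i h' x' -> (join_le H h h' <-> le i x x')).
Hypothesis (E_op : forall i h h' x x',
  E i h x -> E i h' x' -> E i (op h h') (op x x')).
Hypothesis (E_cl : forall i h x, E i h x -> E i (cl h) (cl x)).

(** The spokes [I * X] meet each other only in the hub [H].  A comparison that
    leaves a spoke therefore passes through a glued point [E i k y], and one
    passage through the hub is enough because [E i] preserves and reflects the
    order. *)
Definition glued_le (a b : H + I * X) : Prop :=
  match a, b with
  | inl h, inl h' => join_le H h h'
  | inl h, inr (i, x) => exists k y, E i k y /\ join_le H h k /\ le i y x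
  | inr (i, x), inl h => exists k y, E i k y /\ le i x y /\ join_le H k h
  | inr (i, x), inr (i', x') =>
      (i = i' /\ le i x x') \/
      exists k y k' y', E i k y /\ E i' k' y' /\
        le i x y /\ join_le H k k' /\ le i' y' x'
  end.

Definition glued_op (a b c : H + I * X) : Prop :=
  match a, b, c with
  | inl h, inl h', inl h'' => h'' = op h h'
  | inr (i, x), inr (i', x'), inr (i'', x'') => i = i' /\ i = i'' /\ x'' = op x x'
  | _, _, _ => False
  end.

Definition glued_cl (a b : H + I * X) : Prop :=
  match a, b with
  | inl h, inl h' => h' = cl h
  | inr (i, x), inr (i', x') => i = i' /\ x' = cl x
  | _, _ => False
  end.

Lemma glued_le_spoke i x x' : glued_le (inr (i, x)) (inr (i, x')) <-> le i x x'.
Proof.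
  split; [| simpl; auto].
  intros [[_ Hx] | (k & y & k' & y' & Hy & Hy' & H1 & H2 & H3)]; [exact Hx |].
  apply (cp_trans _ _ _ _ (Hle i) _ y); [exact H1 |].
  apply (cp_trans _ _ _ _ (Hle i) _ y'); [| exact H3].
  apply (E_le _ _ _ _ _ Hy Hy'), H2.
Qed.

Lemma glued_closure_preorder : closure_preorder glued_le glued_op glued_cl.
Proof.
  pose proof (model_total_preorder H HH) as HP.
  pose proof (fun i => cp_refl _ _ _ _ (Hle i)) as R.
  pose proof (fun i => cp_trans _ _ _ _ (Hle i)) as T.
  pose proof (cp_refl _ _ _ _ HP) as RH.
  pose proof (cp_trans _ _ _ _ HP) as TH.
  assert (Lub : forall i x x' u, le i x u -> le i x' u -> le i (op x x') u)
    by (intros; eapply (cp_lub _ _ _ _ (Hle i)); eauto).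
  assert (LubH : forall h h' u, join_le H h u -> join_le H h' u -> join_le H (op h h') u)
    by (intros; eapply (cp_lub _ _ _ _ HP); eauto).
  assert (Ul : forall i x x', le i x (op x x'))
    by (intros; eapply (cp_ub_l _ _ _ _ (Hle i)); eauto).
  assert (Ur : forall i x x', le i x' (op x x'))
    by (intros; eapply (cp_ub_r _ _ _ _ (Hle i)); eauto).
  assert (UlH : forall h h', join_le H h (op h h'))
    by (intros; eapply (cp_ub_l _ _ _ _ HP); eauto).
  assert (UrH : forall h h', join_le H h' (op h h'))
    by (intros; eapply (cp_ub_r _ _ _ _ HP); eauto).
  assert (Ex : forall i x, le i x (cl x))
    by (intros; eapply (cp_ext _ _ _ _ (Hle i)); eauto).
  assert (ExH : forall h, join_le H h (cl h))
    by (intros; eapply (cp_ext _ _ _ _ HP); eauto).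
  assert (Le : forall i x y, le i x (cl y) -> le i (cl x) (cl y))
    by (intros; eapply (cp_least _ _ _ _ (Hle i)); eauto).
  assert (LeH : forall h h', join_le H h (cl h') -> join_le H (cl h) (cl h'))
    by (intros; eapply (cp_least _ _ _ _ HP); eauto).
  assert (Mono : forall i x y, le i x y -> le i (cl x) (cl y)) by eauto.
  assert (MonoH : forall h h', join_le H h h' -> join_le H (cl h) (cl h')) by eauto.
  assert (Hub : forall i k y k' y', E i k y -> E i k' y' -> le i y y' -> join_le H k k')
    by (intros i k y k' y' Hy Hy'; apply (E_le _ _ _ _ _ Hy Hy')).
  split.
  - intros [h | [i x]]; simpl; auto.
  - intros [h | [i x]] [h' | [i' x']] [h'' | [i'' x'']]; simpl.
    + eauto.
    + intros H1 (k & y & Hy & H2 & H3); exists k, y; eauto.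
    + intros (k & y & Hy & H1 & H2) (k' & y' & Hy' & H3 & H4).
      eauto 8.
    + intros (k & y & Hy & H1 & H2) [[<- H3] | (k1 & y1 & k2 & y2 & Hy1 & Hy2 & H3 & H4 & H5)].
      * exists k, y; eauto.
      * exists k2, y2; split; [assumption | split; [| assumption]]. eauto 8.
    + intros (k & y & Hy & H1 & H2) H3; exists k, y; eauto.
    + intros (k & y & Hy & H1 & H2) (k' & y' & Hy' & H3 & H4).
      right; exists k, y, k', y'; eauto 8.
    + intros [[<- H3] | (k1 & y1 & k2 & y2 & Hy1 & Hy2 & H3 & H4 & H5)] (k & y & Hy & H1 & H2).
      * exists k, y; eauto.
      * exists k1, y1; split; [assumption | split; [assumption |]]. eauto 8.
    + intros [[<- H3] | (k1 & y1 & k2 & y2 & Hy1 & Hy2 & H3 & H4 & H5)]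
        [[<- H6] | (k3 & y3 & k4 & y4 & Hy3 & Hy4 & H6 & H7 & H8)].
      * left; eauto.
      * right; exists k3, y3, k4, y4; eauto 8.
      * right; exists k1, y1, k2, y2; eauto 8.
      * right; exists k1, y1, k4, y4; repeat (split; [assumption |]). 
        split; [| assumption]. eauto 8.
  - intros [h | [i x]] [h' | [i' x']] [h'' | [i'' x'']]; simpl; try tauto.
    + intros ->; auto.
    + intros (<- & <- & ->); auto.
  - intros [h | [i x]] [h' | [i' x']] [h'' | [i'' x'']]; simpl; try tauto.
    + intros ->; auto.
    + intros (<- & <- & ->); auto.
  - intros [h | [i x]] [h' | [i' x']] [h'' | [i'' x'']] u HJ; try contradiction HJ.
    + rewrite HJ; destruct u as [g | [j z]]; simpl; auto.
      intros (k & y & Hy & H1 & H2) (k' & y' & Hy' & H3 & H4).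
      exists (op k k'), (op y y'); split; [auto | split; eauto 8].
    + destruct HJ as (<- & <- & ->); destruct u as [g | [j z]].
      * intros (k & y & Hy & H1 & H2) (k' & y' & Hy' & H3 & H4).
        exists (op k k'), (op y y'); split; [auto | split; eauto 8].
      * destruct (classic (i = j)) as [<- | Hij].
        { rewrite !glued_le_spoke; auto. }
        intros [[-> _] | (k & y & k1 & y1 & Hy & Hy1 & H1 & H2 & H3)]; [congruence |].
        intros [[-> _] | (k' & y' & k1' & y1' & Hy' & Hy1' & H1' & H2' & H3')]; [congruence |].
        right; exists (op k k'), (op y y'), (op k1 k1'), (op y1 y1').
        repeat (split; [eauto 8 |]); auto.
  - intros [h | [i x]] [h' | [i' x']]; simpl; try tauto.
    + intros ->; auto.
    + intros (<- & ->); auto.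
  - intros [h | [i x]] [h' | [i' x']] [g | [j z]] [g' | [j' z']]; simpl; try tauto.
    + intros -> ->; auto.
    + intros -> [<- ->] (k & y & Hy & H1 & H2).
      exists (cl k), (cl y); repeat split; auto.
    + intros [<- ->] -> (k & y & Hy & H1 & H2).
      exists (cl k), (cl y); repeat split; auto.
    + intros [<- ->] [<- ->] [[<- H1] | (k & y & k1 & y1 & Hy & Hy1 & H1 & H2 & H3)].
      * left; auto.
      * right; exists (cl k), (cl y), (cl k1), (cl y1); repeat split; auto.
Qed.

(** Nothing collapses in the completion: the glued preorder restricts to the
    given ones on the hub and on each spoke ([glued_le_spoke]).  All spokes share
    the carrier [X] and differ in their preorder only, so that comparing points
    of two spokes involves no equality of types. *)
Lemma gluing :
  exists (D : structure) (f : H -> D) (g : I -> X -> D),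
    model D /\ is_embedding f /\ (forall i, is_hom (g i)) /\
    (forall i x x', g i x = g i x' <-> le i x x' /\ le i x' x) /\
    (forall i h x, E i h x -> f h = g i x).
Proof.
  destruct (completion _ _ _ glued_closure_preorder) as (D & e & HD & He & Hop & Hcl).
  assert (Heq : forall a b, glued_le a b -> glued_le b a -> e a = e b).
  { intros a b Hab Hba; apply join_le_antisym; [exact HD | |]; apply He; assumption. }
  assert (Hge : forall a b, e a = e b -> glued_le a b).
  { intros a b Hab; apply He; rewrite Hab; apply (cp_refl _ _ _ _ (model_total_preorder D HD)). }
  exists D, (fun h => e (inl h)), (fun i x => e (inr (i, x))).
  split; [exact HD | split; [split; [| split] | split; [| split]]].
  - intros h h' Hhh'; apply (join_le_antisym H h h' HH).
    + exact (Hge _ _ Hhh').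
    + exact (Hge _ _ (eq_sym Hhh')).
  - intros h h'; apply Hop; reflexivity.
  - intros h; apply Hcl; reflexivity.
  - intros i; split; intros; [apply Hop | apply Hcl]; simpl; auto.
  - intros i x x'; rewrite <- !glued_le_spoke; split; [| intros []; auto].
    intros Hx; split; apply Hge; auto.
  - intros i h x Hx.
    assert (RH := cp_refl _ _ _ _ (model_total_preorder H HH) h).
    assert (R := cp_refl _ _ _ _ (Hle i) x).
    apply Heq; simpl; exists h, x; auto.
Qed.

End Gluing.

Lemma embedding_le (A B : structure) (f : A -> B) x y :
  is_embedding f -> (join_le B (f x) (f y) <-> join_le A x y).
Proof.
  intros (Hi & Hop & _); unfold join_le; rewrite <- Hop; split; [apply Hi | congruence].
Qed.

(** One spoke [B] glued to the hub [C] along the image of [A]. *)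
Lemma amalgamation : amalgamation_property T_join_closure.
Proof.
  intros A B C f g HA HB HC Hf Hg.
  apply is_model_T_join_closure in HA, HB, HC.
  pose (E := fun (_ : unit) (c : C) (b : B) => exists a, g a = c /\ f a = b).
  destruct (gluing C B unit (fun _ => join_le B) E) as (D & g' & f' & HD & Hg' & Hf' & Hinj & HE).
  - exact HC.
  - intros _; apply model_total_preorder, HB.
  - intros i c c' b b' (a & <- & <-) (a' & <- & <-).
    rewrite !embedding_le by assumption; tauto.
  - intros i c c' b b' (a & <- & <-) (a' & <- & <-).
    exists (op a a'); split; [apply Hg | apply Hf].
  - intros i c b (a & <- & <-); exists (cl a); split; [apply Hg | apply Hf].
  - exists D, (f' tt), g'; split; [apply is_model_T_join_closure, HD | split; [| split]].
    + split; [| apply Hf'].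
      intros b b' H; apply Hinj in H; apply join_le_antisym; [exact HB | |]; tauto.
    + exact Hg'.
    + intros a; symmetry; apply HE; exists a; auto.
Qed.

(** * Rich models *)

(** The form in which the extension property of Fraïssé limits is used: the
    one-point extension is given by its type, which is that of [v] on [m :: F],
    so that the model [A] that it comes from may be of any size.  An empty [F]
    is allowed and expresses universality for one-generated models. *)
Definition rich (N : structure) : Prop :=
  model N /\
  forall (A : structure) (v : nat -> A) (w : nat -> N) F m,
    model A -> ~ In m F -> same_type F v w ->
    exists b, same_type (m :: F) v (update w m b).

Definition term_structure : structure := {|
  carrier := term; op := Op; cl := Cl; carrier_inhabited := inhabits (Var 0)
|}.

Lemma eval_term_structure t : eval term_structure Var t = t.
Proof. induction t; simpl; congruence. Qed.

(** A quantifier-free type extending that of [ext_val] on [ext_vars].  It is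
    recorded as a preorder of terms, and not by a model realising it, because
    the problems over [N] are to form a type in the universe of [N]. *)
Record extension_problem (N : structure) : Type := {
  ext_vars : list nat;
  ext_val : nat -> N;
  ext_le : term -> term -> Prop;
  ext_preorder : total_preorder term_structure ext_le;
  ext_extends : forall s t, over ext_vars s -> over ext_vars t ->
    (join_le N (eval N ext_val s) (eval N ext_val t) <-> ext_le s t)
}.
Arguments ext_vars {N} _.
Arguments ext_val {N} _ _.
Arguments ext_le {N} _ _ _.

(** The hub is [N] and the spokes are the extension problems, with the terms as
    common carrier; a variable outside [ext_vars] becomes a new element. *)
Lemma one_step_extension (N : structure) :
  model N ->
  exists (N' : structure) (e : N -> N'),
    model N' /\ is_embedding e /\
    forall (A : structure) (v : nat -> A) (w : nat -> N) F m,
      model A -> ~ In m F -> same_type F v w ->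
      exists b, same_type (m :: F) v (update (fun n => e (w n)) m b).
Proof.
  intros HN.
  pose (E := fun (p : extension_problem N) (h : N) (t : term) =>
    over (ext_vars p) t /\ h = eval N (ext_val p) t).
  destruct (gluing N term_structure (extension_problem N) (@ext_le N) E)
    as (D & f & g & HD & Hf & Hg & Hinj & HE).
  - exact HN.
  - apply ext_preorder.
  - intros p h h' s t [Hs ->] [Ht ->]; apply ext_extends; assumption.
  - intros p h h' s t [Hs ->] [Ht ->]; split; [| reflexivity].
    intros n [Hn | Hn]; auto.
  - intros p h s [Hs ->]; split; [exact Hs | reflexivity].
  - exists D, f; split; [exact HD | split; [exact Hf |]].
    intros A v w F m HA Hm Hvw.
    assert (HP : total_preorder term_structure
      (fun s t => join_le A (eval A v s) (eval A v t))).
    { destruct (model_total_preorder A HA) as [R T Ul Ur Lub Ex Le].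
      split; intros; subst; simpl in *; eauto. }
    assert (HX : forall s t, over F s -> over F t ->
      (join_le N (eval N w s) (eval N w t) <-> join_le A (eval A v s) (eval A v t))).
    { intros s t Hs Ht; symmetry; apply (Hvw (Op s t) t); [| exact Ht].
      intros n [Hn | Hn]; auto. }
    pose (p := Build_extension_problem N F w _ HP HX).
    assert (Hval : forall t, eval D (fun n => g p (Var n)) t = g p t).
    { intros t; rewrite <- (eval_hom term_structure D (g p) Var t (Hg p)).
      rewrite eval_term_structure; reflexivity. }
    exists (g p (Var m)).
    apply (same_type_trans _ D _ _ _ (fun n => g p (Var n))).
    + intros s t _ _; rewrite !Hval.
      pose proof (cp_refl _ _ _ _ (model_total_preorder A HA)) as R.
      split.
      * intros Hst; apply Hinj; simpl; rewrite Hst; auto.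
      * intros Hst; apply Hinj in Hst; apply join_le_antisym; tauto.
    + apply same_type_agree; intros n Hn.
      destruct (Nat.eq_dec n m) as [-> | Hnm]; [rewrite update_same; reflexivity |].
      rewrite update_other by exact Hnm; symmetry; apply HE.
      split; [| reflexivity].
      intros k Hk; simpl in Hk; subst k; destruct Hn; [congruence | assumption].
Qed.

Section Colimit.

Context (N : nat -> structure) (e : forall i, N i -> N (S i)).
Hypothesis (HN : forall i, model (N i)).
Hypothesis (He : forall i, is_embedding (e i)).

Definition coherent_from (i : nat) (s : forall k, N k) : Prop :=
  forall k, i <= k -> s (S k) = e k (s k).

Lemma coherent_from_le i j s : i <= j -> coherent_from i s -> coherent_from j s.
Proof. intros Hij Hs k Hk; apply Hs; lia. Qed.

Lemma coherent_agree i s t :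
  coherent_from i s -> coherent_from i t -> s i = t i ->
  forall k, i <= k -> s k = t k.
Proof.
  intros Hs Ht Hst k Hk; induction Hk as [| k Hk IH]; [exact Hst |].
  rewrite (Hs k Hk), (Ht k Hk), IH; reflexivity.
Qed.

Lemma coherent_agree_back i s t k :
  coherent_from i s -> coherent_from i t -> i <= k -> s k = t k -> s i = t i.
Proof.
  intros Hs Ht Hk; induction Hk as [| k Hk IH]; [auto |].
  rewrite (Hs k Hk), (Ht k Hk); intros H; apply IH, (He k), H.
Qed.

Lemma coherent_op i s t :
  coherent_from i s -> coherent_from i t -> coherent_from i (fun k => op (s k) (t k)).
Proof.
  intros Hs Ht k Hk; rewrite (Hs k Hk), (Ht k Hk); symmetry; apply (He k).
Qed.

Lemma coherent_cl i s : coherent_from i s -> coherent_from i (fun k => cl (s k)).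
Proof. intros Hs k Hk; rewrite (Hs k Hk); symmetry; apply (He k). Qed.

End Colimit.

(** The induction on [i] shifts the chain by one, which avoids any transport
    between the types of different stages. *)
Lemma coherent_thread (N : nat -> structure) (e : forall i, N i -> N (S i)) i (x : N i) :
  exists s : forall k, N k, s i = x /\ coherent_from N e i s.
Proof.
  revert N e x; induction i as [| i IH]; intros N e x.
  - exists (nat_rect (fun k => N k) x (fun k y => e k y)); split; [reflexivity |].
    intros k _; reflexivity.
  - destruct (IH (fun k => N (S k)) (fun k => e (S k)) x) as (s & Hs & Hc).
    destruct (carrier_inhabited (N 0)) as [x0].
    exists (nat_rect (fun k => N k) x0 (fun k _ => s k)); split; [exact Hs |].
    intros [| k] Hk; [lia |]; apply Hc; lia.
Qed.

(** The colimit consists of the eventually coherent threads, up to eventual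
    equality. *)
Lemma chain_colimit (N : nat -> structure) (e : forall i, N i -> N (S i)) :
  (forall i, model (N i)) -> (forall i, is_embedding (e i)) ->
  exists (L : structure) (l : forall i, N i -> L),
    model L /\ (forall i, is_embedding (l i)) /\
    (forall i x, l (S i) (e i x) = l i x) /\
    (forall z, exists i x, l i x = z).
Proof.
  intros HN He.
  pose (P := fun s : forall k, N k => exists i, coherent_from N e i s).
  assert (Pop : forall s t, P s -> P t -> P (fun k => op (s k) (t k))).
  { intros s t [i Hs] [j Ht]; exists (max i j).
    apply coherent_op; [exact He | |];
      (eapply coherent_from_le; [| eassumption]); lia. }
  assert (Pcl : forall s, P s -> P (fun k => cl (s k))).
  { intros s [i Hs]; exists i; apply coherent_cl; assumption. }
  destruct (carrier_inhabited (N 0)) as [x0].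
  destruct (coherent_thread N e 0 x0) as (s0 & _ & Hs0).
  pose (X := {|
    carrier := {s | P s};
    op := fun s t => exist P (fun k => op (proj1_sig s k) (proj1_sig t k))
                       (Pop _ _ (proj2_sig s) (proj2_sig t));
    cl := fun s => exist P (fun k => cl (proj1_sig s k)) (Pcl _ (proj2_sig s));
    carrier_inhabited := inhabits (exist P s0 (ex_intro _ 0 Hs0))
  |}).
  pose (le := fun s t : X =>
    exists i, forall k, i <= k -> join_le (N k) (proj1_sig s k) (proj1_sig t k)).
  destruct (quotient X le) as (L & p & HL & [Hop Hcl] & Hp & Hle).
  { pose proof (fun k => model_total_preorder _ (HN k)) as M.
    split.
    - intros s; exists 0; intros k _; apply (cp_refl _ _ _ _ (M k)).
    - intros s t u [i Hi] [j Hj]; exists (max i j); intros k Hk.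
      apply (cp_trans _ _ _ _ (M k) _ (proj1_sig t k)); [apply Hi | apply Hj]; lia.
    - intros s t u ->; exists 0; intros k _; eapply (cp_ub_l _ _ _ _ (M k)); reflexivity.
    - intros s t u ->; exists 0; intros k _; eapply (cp_ub_r _ _ _ _ (M k)); reflexivity.
    - intros s t u z -> [i Hi] [j Hj]; exists (max i j); intros k Hk.
      eapply (cp_lub _ _ _ _ (M k)); [reflexivity | apply Hi | apply Hj]; lia.
    - intros s t ->; exists 0; intros k _; eapply (cp_ext _ _ _ _ (M k)); reflexivity.
    - intros s s' t t' -> -> [i Hi]; exists i; intros k Hk.
      eapply (cp_least _ _ _ _ (M k)); [reflexivity | reflexivity | apply Hi, Hk]. }
  assert (peq : forall s t : X,
    p s = p t <-> exists i, forall k, i <= k -> proj1_sig s k = proj1_sig t k).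
  { intros s t; split.
    - intros H.
      assert (Hst : le s t /\ le t s).
      { pose proof (cp_refl _ _ _ _ (model_total_preorder _ HL)) as R.
        split; apply Hle; rewrite H; apply R. }
      destruct Hst as [[i Hi] [j Hj]]; exists (max i j); intros k Hk.
      apply join_le_antisym; [apply HN | apply Hi | apply Hj]; lia.
    - intros [i Hi]; apply join_le_antisym; [exact HL | |]; apply Hle; exists i;
        intros k Hk; rewrite (Hi k Hk); apply (cp_refl _ _ _ _ (model_total_preorder _ (HN k))). }
  pose (thread := fun i (x : N i) => constructive_indefinite_description _ (coherent_thread N e i x)).
  assert (tP : forall i x, P (proj1_sig (thread i x))).
  { intros i x; exists i; apply (proj2_sig (thread i x)). }
  pose (l := fun i x => p (exist P _ (tP i x))).
  assert (lp : forall i x (s : X),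
    coherent_from N e i (proj1_sig s) -> proj1_sig s i = x -> l i x = p s).
  { intros i x s Hs Hx; apply peq; exists i; apply (coherent_agree N e).
    - apply (proj2_sig (thread i x)).
    - exact Hs.
    - rewrite Hx; apply (proj2_sig (thread i x)). }
  exists L, l; split; [exact HL | split; [| split]].
  - intros i; split; [| split].
    + intros x y H; apply peq in H; destruct H as [j Hj]; simpl in Hj.
      destruct (proj2_sig (thread i x)) as [Ex Hx].
      destruct (proj2_sig (thread i y)) as [Ey Hy].
      transitivity (proj1_sig (thread i x) i); [symmetry; exact Ex |].
      transitivity (proj1_sig (thread i y) i); [| exact Ey].
      apply (coherent_agree_back N e He i _ _ (max i j)); [assumption | assumption | lia |].
      apply Hj; lia.
    + intros x y; unfold l at 2 3; rewrite <- Hop; apply lp; simpl.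
      * apply coherent_op; [exact He | |]; apply (proj2_sig (thread _ _)).
      * rewrite (proj1 (proj2_sig (thread i x))), (proj1 (proj2_sig (thread i y))); reflexivity.
    + intros x; unfold l at 2; rewrite <- Hcl; apply lp; simpl.
      * apply coherent_cl; [exact He |]; apply (proj2_sig (thread _ _)).
      * rewrite (proj1 (proj2_sig (thread i x))); reflexivity.
  - intros i x; apply lp; simpl; destruct (proj2_sig (thread i x)) as [Hx Hc].
    + apply (coherent_from_le _ _ i); [lia | exact Hc].
    + rewrite (Hc i (le_n i)), Hx; reflexivity.
  - intros z; destruct (Hp z) as [[s [i Hs]] <-].
    exists i, (s i); apply lp; [exact Hs | reflexivity].
Qed.

(** A finite tuple of the colimit lives in some stage, and the next stage
    realises every type over it. *)
Lemma rich_model_exists : exists N, rich N.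
Proof.
  pose (solves := fun (N N' : structure) (e : N -> N') =>
    is_embedding e /\
    forall (A : structure) (v : nat -> A) (w : nat -> N) F m,
      model A -> ~ In m F -> same_type F v w ->
      exists b, same_type (m :: F) v (update (fun n => e (w n)) m b)).
  assert (step : forall N : {N | model N},
    {N' : {N | model N} | exists e, solves (proj1_sig N) (proj1_sig N') e}).
  { intros [N HN]; apply constructive_indefinite_description.
    destruct (one_step_extension N HN) as (N' & e & HN' & He).
    exists (exist _ N' HN'), e; exact He. }
  pose (one := {| carrier := unit; op := fun _ _ => tt; cl := fun _ => tt;
                  carrier_inhabited := inhabits tt |}).
  assert (Hone : model one).
  { assert (U : forall x y : one, x = y) by (intros [] []; reflexivity).
    repeat split; intros; apply U. }
  pose (chain := nat_rect (fun _ => {N | model N}) (exist _ one Hone)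
    (fun _ N => proj1_sig (step N))).
  assert (links : forall i, {e | solves (proj1_sig (chain i)) (proj1_sig (chain (S i))) e}).
  { intros i; apply constructive_indefinite_description, (proj2_sig (step (chain i))). }
  destruct (chain_colimit (fun i => proj1_sig (chain i)) (fun i => proj1_sig (links i)))
    as (L & l & HL & Hl & Hcomp & Hsurj).
  { intros i; apply (proj2_sig (chain i)). }
  { intros i; apply (proj2_sig (links i)). }
  exists L; split; [exact HL |].
  intros A v w F m HA Hm Hvw.
  assert (Hup : forall i k z, i <= k -> (exists x, l i x = z) -> exists x, l k x = z).
  { intros i k z Hk Hz; induction Hk as [| k Hk [x <-]]; [exact Hz |].
    exists (proj1_sig (links k) x); apply Hcomp. }
  assert (Hstage : exists i, forall n, In n F -> exists x, l i x = w n).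
  { clear - Hsurj Hup; induction F as [| n F [i Hi]].
    - exists 0; intros n [].
    - destruct (Hsurj (w n)) as (j & x & Hx); exists (max i j).
      intros n' [<- | Hn']; [apply (Hup j) | apply (Hup i)]; [lia | eauto | lia | auto]. }
  destruct Hstage as [i Hi].
  destruct (carrier_inhabited (proj1_sig (chain i))) as [x0].
  assert (Hw' : forall n, exists x, In n F -> l i x = w n).
  { intros n; destruct (classic (In n F)) as [Hn | Hn].
    - destruct (Hi n Hn) as [x Hx]; exists x; auto.
    - exists x0; tauto. }
  pose (w' := fun n => proj1_sig (constructive_indefinite_description _ (Hw' n))).
  assert (Hlw : forall n, In n F -> l i (w' n) = w n).
  { intros n; apply (proj2_sig (constructive_indefinite_description _ (Hw' n))). }
  destruct (proj2_sig (links i)) as [He Hsolve].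
  destruct (Hsolve A v w' F m HA Hm) as [b Hb].
  { apply (same_type_trans _ L _ _ _ w); [exact Hvw |].
    apply (same_type_trans _ L _ _ _ (fun n => l i (w' n))).
    - apply same_type_agree; intros n Hn; symmetry; auto.
    - apply same_type_sym, same_type_embedding, Hl. }
  exists (l (S i) b).
  eapply same_type_trans; [exact Hb |].
  eapply same_type_trans; [apply (same_type_embedding _ _ _ _ _ (Hl (S i))) |].
  rewrite update_comp; apply same_type_agree; intros n [<- | Hn].
  - rewrite !update_same; reflexivity.
  - rewrite !update_other by congruence; rewrite Hcomp; auto.
Qed.

(** * Local finiteness *)

Definition models_eq (s t : term) : Prop :=
  forall (A : structure) (v : nat -> A), model A -> eval A v s = eval A v t.

Fixpoint joins (L : list term) : list term :=
  match L with
  | [] => []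
  | t :: L => t :: joins L ++ map (Op t) (joins L)
  end.

Lemma in_joins L t : In t L -> In t (joins L).
Proof.
  induction L as [| s L IH]; simpl; [tauto |].
  intros [-> | H]; [auto |]; right; apply in_or_app; auto.
Qed.

Lemma joins_ind (P : term -> Prop) L :
  (forall t, In t L -> P t) -> (forall s t, P s -> P t -> P (Op s t)) ->
  forall t, In t (joins L) -> P t.
Proof.
  intros HL HP; induction L as [| s L IH]; simpl; [tauto |].
  assert (IH' : forall t, In t (joins L) -> P t) by (apply IH; intros; apply HL; simpl; auto).
  intros t [<- | Ht]; [apply HL; simpl; auto |].
  apply in_app_or in Ht; destruct Ht as [Ht | Ht]; [auto |].
  apply in_map_iff in Ht; destruct Ht as (t' & <- & Ht); apply HP; [apply HL; simpl; auto | auto].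
Qed.

Lemma joins_op L s t :
  In s (joins L) -> In t (joins L) -> exists u, In u (joins L) /\ models_eq (Op s t) u.
Proof.
  revert s t; induction L as [| x L IH]; intros s t; simpl; [tauto |].
  rewrite !in_app_iff, !in_map_iff.
  assert (Hin : forall u, In u (joins L) ->
    x = Op x u \/ In (Op x u) (joins L ++ map (Op x) (joins L))).
  { intros u Hu; right; apply in_or_app; right; apply in_map, Hu. }
  intros [<- | [Hs | (s' & <- & Hs)]] [<- | [Ht | (t' & <- & Ht)]].
  - exists x; split; [auto |]. intros A v ((As & Co & Id) & _); simpl; auto.
  - exists (Op x t); split; [auto |]. intros A v _; reflexivity.
  - exists (Op x t'); split; [auto |].
    intros A v ((As & Co & Id) & _); simpl; rewrite As, Id; reflexivity.
  - exists (Op x s); split; [auto |]. intros A v ((As & Co & Id) & _); simpl; apply Co.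
  - destruct (IH s t Hs Ht) as (u & Hu & Eu); exists u; split; [| exact Eu].
    right; apply in_or_app; auto.
  - destruct (IH s t' Hs Ht) as (u & Hu & Eu); exists (Op x u); split; [auto |].
    intros A v HA; simpl; rewrite <- (Eu A v HA); simpl.
    destruct HA as ((As & Co & Id) & _).
    rewrite !As, (Co (eval A v s)); reflexivity.
  - exists (Op x s'); split; [auto |].
    intros A v ((As & Co & Id) & _); simpl.
    rewrite Co, As, Id; reflexivity.
  - destruct (IH s' t Hs Ht) as (u & Hu & Eu); exists (Op x u); split; [auto |].
    intros A v HA; simpl; rewrite <- (Eu A v HA); simpl.
    destruct HA as ((As & Co & Id) & _); rewrite As; reflexivity.
  - destruct (IH s' t' Hs Ht) as (u & Hu & Eu); exists (Op x u); split; [auto |].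
    intros A v HA; simpl; rewrite <- (Eu A v HA); simpl.
    destruct HA as ((As & Co & Id) & _).
    rewrite <- As, (As (eval A v s')), (Co (eval A v s')), <- (As (eval A v x) (eval A v s')), As, Id.
    reflexivity.
Qed.

Lemma cl_op_cl (A : structure) (x y : A) : model A -> cl (op x y) = cl (op (cl x) (cl y)).
Proof.
  intros HA; pose proof (model_total_preorder A HA) as [R T Ul Ur Lub Ex Le].
  apply join_le_antisym; [exact HA | |]; (eapply Le; [reflexivity | reflexivity |]).
  - eapply Lub; [reflexivity | |].
    + apply (T _ (cl x)); [eapply Ex; reflexivity |].
      apply (T _ (op (cl x) (cl y))); [eapply Ul; reflexivity | eapply Ex; reflexivity].
    + apply (T _ (cl y)); [eapply Ex; reflexivity |].
      apply (T _ (op (cl x) (cl y))); [eapply Ur; reflexivity | eapply Ex; reflexivity].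
  - eapply Lub; [reflexivity | |]; (eapply Le; [reflexivity | reflexivity |]);
      (apply (T _ (op x y)); [| eapply Ex; reflexivity]);
      [eapply Ul | eapply Ur]; reflexivity.
Qed.

Definition normal_terms (F : list nat) : list term :=
  joins (map Var F ++ map Cl (joins (map Var F))).

Lemma over_normal_terms F t : In t (normal_terms F) -> over F t.
Proof.
  assert (Hv : forall s, In s (joins (map Var F)) -> over F s).
  { apply joins_ind.
    - intros s Hs; apply in_map_iff in Hs; destruct Hs as (n & <- & Hn).
      intros m Hm; simpl in Hm; subst; exact Hn.
    - intros s s' H H' n [Hn | Hn]; auto. }
  revert t; apply joins_ind.
  - intros s Hs; apply in_app_or in Hs; destruct Hs as [Hs | Hs].
    + apply Hv, in_joins, Hs.
    + apply in_map_iff in Hs; destruct Hs as (s' & <- & Hs'); exact (Hv s' Hs').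
  - intros s s' H H' n [Hn | Hn]; auto.
Qed.

(** Since [cl (op x (cl y)) = cl (op x y)], nested closures collapse: every
    term is a join of variables and of closures of joins of variables. *)
Lemma normal_form F t : over F t -> exists t', In t' (normal_terms F) /\ models_eq t t'.
Proof.
  assert (Hcl : forall u, In u (normal_terms F) ->
    exists r, In r (joins (map Var F)) /\ models_eq (Cl u) (Cl r)).
  { apply joins_ind.
    - intros s Hs; apply in_app_or in Hs; destruct Hs as [Hs | Hs].
      + exists s; split; [apply in_joins, Hs | intros A v _; reflexivity].
      + apply in_map_iff in Hs; destruct Hs as (r & <- & Hr).
        exists r; split; [exact Hr |]. intros A v HA; simpl; apply HA.
    - intros s t' (r & Hr & Er) (r' & Hr' & Er').
      destruct (joins_op _ _ _ Hr Hr') as (u & Hu & Eu).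
      exists u; split; [exact Hu |].
      intros A v HA; specialize (Er A v HA); specialize (Er' A v HA); specialize (Eu A v HA).
      simpl in *; rewrite cl_op_cl, Er, Er', <- cl_op_cl, Eu by exact HA; reflexivity. }
  induction t as [n | s IHs t IHt | t IHt]; intros Ht.
  - exists (Var n); split; [| intros A v _; reflexivity].
    apply in_joins, in_or_app; left; apply in_map, Ht; reflexivity.
  - destruct IHs as (s' & Hs' & Es); [intros n Hn; apply Ht; simpl; auto |].
    destruct IHt as (t' & Ht' & Et); [intros n Hn; apply Ht; simpl; auto |].
    destruct (joins_op _ _ _ Hs' Ht') as (u & Hu & Eu).
    exists u; split; [exact Hu |].
    intros A v HA; rewrite <- (Eu A v HA); simpl; rewrite (Es A v HA), (Et A v HA); reflexivity.
  - destruct IHt as (t' & Ht' & Et); [exact Ht |].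
    destruct (Hcl t' Ht') as (r & Hr & Er).
    exists (Cl r); split.
    + apply in_joins, in_or_app; right; apply in_map, Hr.
    + intros A v HA; rewrite <- (Er A v HA); simpl; rewrite (Et A v HA); reflexivity.
Qed.

Definition type_atoms (F : list nat) : list formula :=
  map (fun p => Eq (fst p) (snd p)) (list_prod (normal_terms F) (normal_terms F)).

Lemma type_atoms_spec F a :
  In a (type_atoms F) ->
  quantifier_free a /\ forall n, free n a -> In n F.
Proof.
  unfold type_atoms; rewrite in_map_iff; intros ([s t] & <- & H).
  apply in_prod_iff in H; destruct H as [Hs Ht]; split; [exact I |].
  intros n [Hn | Hn]; [apply (over_normal_terms F s Hs n Hn) | apply (over_normal_terms F t Ht n Hn)].
Qed.

(** Local finiteness makes a type a matter of finitely many atoms, hence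
    expressible by one formula. *)
Lemma same_type_of_atoms (A B : structure) F (v : nat -> A) (w : nat -> B) :
  model A -> model B ->
  (forall a, In a (type_atoms F) -> (sat A v a <-> sat B w a)) -> same_type F v w.
Proof.
  intros HA HB H s t Hs Ht.
  destruct (normal_form F s Hs) as (s' & Hs' & Es).
  destruct (normal_form F t Ht) as (t' & Ht' & Et).
  rewrite (Es A v HA), (Es B w HB), (Et A v HA), (Et B w HB).
  apply (H (Eq s' t')), in_map_iff; exists (s', t'); split; [reflexivity |].
  apply in_prod; assumption.
Qed.

Lemma same_type_qf (A B : structure) F (v : nat -> A) (w : nat -> B) phi :
  same_type F v w -> quantifier_free phi -> (forall n, free n phi -> In n F) ->
  (sat A v phi <-> sat B w phi).
Proof.
  intros H; induction phi as [| s t | phi1 IH1 phi2 IH2 | n phi IH]; simpl; intros Hq Hf.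
  - tauto.
  - apply H; intros n Hn; auto.
  - rewrite IH1, IH2 by intuition; tauto.
  - contradiction.
Qed.

(** * Quantifier elimination *)

Definition Neg (phi : formula) : formula := Imp phi Bot.
Definition Conj (phi psi : formula) : formula := Neg (Imp phi (Neg psi)).

Lemma sat_Conj A v phi psi : sat A v (Conj phi psi) <-> sat A v phi /\ sat A v psi.
Proof. simpl; tauto. Qed.

(** A property that depends only on the truth values of finitely many atoms is a
    Boolean combination of them. *)
Lemma qf_definable (N : structure) (L : list formula) (Q : (nat -> N) -> Prop) :
  (forall a, In a L -> quantifier_free a) ->
  (forall v w, (forall a, In a L -> (sat N v a <-> sat N w a)) -> Q v -> Q w) ->
  exists psi, quantifier_free psi /\
    (forall n, free n psi -> exists a, In a L /\ free n a) /\
    forall v, sat N v psi <-> Q v.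
Proof.
  revert Q; induction L as [| a L IH]; intros Q HL HQ.
  - assert (HQ' : forall v w, Q v -> Q w) by (intros v w; apply HQ; intros a []).
    destruct (classic (exists v, Q v)) as [[v0 Hv0] | H0].
    + exists (Neg Bot); simpl; split; [tauto | split; [tauto |]].
      intros v; split; [intros _; apply (HQ' v0), Hv0 | tauto].
    + exists Bot; simpl; split; [tauto | split; [tauto |]].
      intros v; split; [tauto |]; intros Hv; apply H0; exists v; exact Hv.
  - (* [Q b] holds of the tuples agreeing on [L] with one that satisfies [Q] and
       gives [a] the truth value [b]. *)
    pose (Qb := fun (b : Prop) (v : nat -> N) => exists u, Q u /\ (sat N u a <-> b) /\
      forall c, In c L -> (sat N u c <-> sat N v c)).
    assert (HQb : forall b, exists psi, quantifier_free psi /\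
      (forall n, free n psi -> exists c, In c L /\ free n c) /\
      forall v, sat N v psi <-> Qb b v).
    { intros b; apply IH; [intros; apply HL; simpl; auto |].
      intros v w Hvw (u & Hu & Hb & Huv); exists u; split; [exact Hu | split; [exact Hb |]].
      intros c Hc; rewrite (Huv c Hc); apply Hvw, Hc. }
    destruct (HQb True) as (p1 & q1 & f1 & s1); destruct (HQb False) as (p0 & q0 & f0 & s0).
    assert (Ha : quantifier_free a) by (apply HL; simpl; auto).
    exists (Conj (Imp a p1) (Imp (Neg a) p0)); split; [simpl; tauto | split].
    + assert (f1' : forall n, free n p1 -> exists c, In c (a :: L) /\ free n c)
        by (intros n Hn; destruct (f1 n Hn) as (c & Hc & Hc'); exists c; simpl; auto).
      assert (f0' : forall n, free n p0 -> exists c, In c (a :: L) /\ free n c)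
        by (intros n Hn; destruct (f0 n Hn) as (c & Hc & Hc'); exists c; simpl; auto).
      assert (fa : forall n, free n a -> exists c, In c (a :: L) /\ free n c)
        by (intros n Hn; exists a; simpl; auto).
      intros n Hn; simpl in Hn.
      repeat destruct Hn as [Hn | Hn]; try contradiction; auto.
    + intros v; rewrite sat_Conj.
      change (((sat N v a -> sat N v p1) /\ (~ sat N v a -> sat N v p0)) <-> Q v).
      rewrite s1, s0; split.
      * intros [H1 H0].
        destruct (classic (sat N v a)) as [Hv | Hv];
          [destruct (H1 Hv) as (u & Hu & Hua & Huv) | destruct (H0 Hv) as (u & Hu & Hua & Huv)];
          (apply (HQ u v); [| exact Hu]); intros c [<- | Hc]; auto; tauto.
      * intros Hv; split; intros Ha'; exists v; (split; [exact Hv | split; [tauto |]]);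
          intros; tauto.
Qed.

Lemma isolating_formula (A : structure) (v : nat -> A) F :
  exists psi, quantifier_free psi /\ (forall n, free n psi -> In n F) /\ sat A v psi /\
    forall (B : structure) (w : nat -> B),
      model A -> model B -> sat B w psi -> same_type F v w.
Proof.
  assert (HL : forall L : list formula,
    (forall a, In a L -> quantifier_free a /\ forall n, free n a -> In n F) ->
    exists psi, quantifier_free psi /\ (forall n, free n psi -> In n F) /\ sat A v psi /\
      forall (B : structure) (w : nat -> B), sat B w psi ->
        forall a, In a L -> (sat A v a <-> sat B w a)).
  { induction L as [| a L IH]; intros HL.
    - exists (Neg Bot); simpl; tauto.
    - destruct IH as (p & Hq & Hf & Hp & HB); [intros; apply HL; simpl; auto |].
      destruct (HL a) as [Ha Hfa]; [simpl; auto |].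
      destruct (classic (sat A v a)) as [Hv | Hv].
      + exists (Conj a p); rewrite sat_Conj.
        split; [simpl; tauto | split; [| split; [tauto |]]].
        * intros n Hn; simpl in Hn; repeat destruct Hn as [Hn | Hn]; try contradiction; auto.
        * intros B w Hw; rewrite sat_Conj in Hw; intros c [<- | Hc]; [tauto |].
          apply HB; tauto.
      + exists (Conj (Neg a) p); rewrite sat_Conj.
        split; [simpl; tauto | split; [| split; [simpl; tauto |]]].
        * intros n Hn; simpl in Hn; repeat destruct Hn as [Hn | Hn]; try contradiction; auto.
        * intros B w Hw; rewrite sat_Conj in Hw; simpl in Hw; intros c [<- | Hc]; [tauto |].
          apply HB; tauto. }
  destruct (HL (type_atoms F) (type_atoms_spec F)) as (p & Hq & Hf & Hp & HB).
  exists p; split; [exact Hq | split; [exact Hf | split; [exact Hp |]]].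
  intros B w MA MB Hw; apply same_type_of_atoms; auto.
Qed.

Lemma free_variables phi : exists F, forall n, In n F <-> free n phi.
Proof.
  assert (Ht : forall t, exists F, forall n, In n F <-> occurs n t).
  { induction t as [m | s [F HF] t [G HG] | t [F HF]]; simpl.
    - exists [m]; simpl; tauto.
    - exists (F ++ G); intros n; rewrite in_app_iff, HF, HG; tauto.
    - exists F; exact HF. }
  induction phi as [| s t | phi1 [F HF] phi2 [G HG] | m phi [F HF]]; simpl.
  - exists []; simpl; tauto.
  - destruct (Ht s) as [F HF]; destruct (Ht t) as [G HG].
    exists (F ++ G); intros n; rewrite in_app_iff, HF, HG; tauto.
  - exists (F ++ G); intros n; rewrite in_app_iff, HF, HG; tauto.
  - exists (remove Nat.eq_dec m F); intros n; split.
    + intros Hn; apply in_remove in Hn; rewrite <- HF; intuition.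
    + intros [Hnm Hn]; apply in_in_remove; [congruence | apply HF, Hn].
Qed.

(** Formulas with free variables are covered through their universal closure. *)
Lemma Th_transfer (N A : structure) phi : is_model (Th N) A -> valid_in N phi -> valid_in A phi.
Proof.
  intros HA HN; destruct (free_variables phi) as [F HF].
  assert (Hc : forall L, valid_in N (fold_right All phi L) /\
    (valid_in A (fold_right All phi L) -> valid_in A phi) /\
    forall n, free n (fold_right All phi L) -> free n phi /\ ~ In n L).
  { induction L as [| m L (H1 & H2 & H3)]; simpl; [tauto |].
    split; [| split].
    - intros v a; apply H1.
    - intros H; apply H2; intros v.
      specialize (H v (v m)); rewrite update_id in H; exact H.
    - intros n [Hnm Hn]; destruct (H3 n Hn); split; [assumption |]; intros []; auto. }
  destruct (Hc F) as (H1 & H2 & H3); apply H2, HA; split; [| exact H1].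
  intros n Hn; destruct (H3 n Hn) as [Hn1 Hn2]; apply Hn2, HF, Hn1.
Qed.

(** The back-and-forth argument: a quantifier is matched by a one-point extension. *)
Lemma rich_homogeneous (N : structure) (v w : nat -> N) F phi :
  rich N -> same_type F v w -> (forall n, free n phi -> In n F) ->
  (sat N v phi <-> sat N w phi).
Proof.
  intros [HN HR]; revert v w F; induction phi as [| s t | phi1 IH1 phi2 IH2 | m phi IH];
    intros v w F Hvw HF; simpl.
  - tauto.
  - apply Hvw; intros n Hn; apply HF; simpl; auto.
  - rewrite (IH1 v w F), (IH2 v w F); try tauto; intros; try apply HF; simpl; auto.
  - assert (Hall : forall v w : nat -> N, same_type F v w ->
      sat N v (All m phi) -> sat N w (All m phi)).
    { clear v w Hvw; intros v w Hvw Hv a.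
      destruct (HR N (update w m a) v (remove Nat.eq_dec m F) m HN) as [b Hb].
      - apply remove_In.
      - apply (same_type_trans _ N _ _ _ w).
        + apply same_type_agree; intros n Hn; apply in_remove in Hn.
          apply update_other; tauto.
        + apply same_type_sym, (same_type_incl _ _ F); [| exact Hvw].
          intros n Hn; apply in_remove in Hn; tauto.
      - apply (IH _ _ _ Hb); [| apply Hv].
        intros n Hn; destruct (Nat.eq_dec m n) as [-> | Hmn]; [left; reflexivity | right].
        apply in_in_remove; [congruence |]; apply HF; simpl; auto. }
    split; apply Hall; [| apply same_type_sym]; exact Hvw.
Qed.

Lemma Th_model (N A : structure) : model N -> is_model (Th N) A -> model A.
Proof.
  intros HN HA; apply is_model_T_join_closure; intros phi Hphi; apply HA; split.
  - apply T_join_closure_is_theory, Hphi.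
  - apply is_model_T_join_closure; assumption.
Qed.

Lemma rich_quantifier_elimination (N : structure) :
  rich N -> has_quantifier_elimination (Th N).
Proof.
  intros HN phi; destruct (free_variables phi) as [F HF].
  destruct (qf_definable N (type_atoms F) (fun v => sat N v phi)) as (psi & Hq & Hf & Hs).
  - intros a Ha; apply (type_atoms_spec F), Ha.
  - intros v w Hvw; apply (rich_homogeneous N v w F phi HN).
    + apply same_type_of_atoms; [apply HN | apply HN | exact Hvw].
    + intros n Hn; apply HF, Hn.
  - exists psi; split; [exact Hq | split; [| split]].
    + intros n Hn; destruct (Hf n Hn) as (a & Ha & Hna).
      apply HF, (proj2 (type_atoms_spec F a Ha) n Hna).
    + intros A HA; apply (Th_transfer N A _ HA); intros v; simpl; rewrite Hs; auto.
    + intros A HA; apply (Th_transfer N A _ HA); intros v; simpl; rewrite Hs; auto.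
Qed.

Lemma quantifier_elimination_model_complete (T : formula -> Prop) :
  has_quantifier_elimination T -> model_complete T.
Proof.
  intros HQ A B f HA HB Hf phi v.
  destruct (HQ phi) as (psi & Hq & _ & H1 & H2).
  assert (H : forall C, is_model T C -> forall u, sat C u phi <-> sat C u psi)
    by (intros C HC u; split; [apply (H1 C HC) | apply (H2 C HC)]).
  rewrite (H A HA), (H B HB).
  destruct (free_variables psi) as [F HF].
  apply (same_type_qf _ _ F); [apply same_type_embedding, Hf | exact Hq |].
  intros n Hn; apply HF, Hn.
Qed.

(** A counterexample in [A] is copied into [N] one quantifier at a time. *)
Lemma rich_universal (N A : structure) phi F (v : nat -> A) (w : nat -> N) :
  rich N -> model A -> universal phi -> same_type F v w ->
  (forall n, free n phi -> In n F) -> sat N w phi -> sat A v phi.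
Proof.
  intros [HN HR] HA Hu; revert F v w; induction Hu as [phi Hq | m phi Hu IH];
    intros F v w Hvw HF Hw.
  - apply (same_type_qf _ _ F v w); assumption.
  - intros a.
    destruct (HR A (update v m a) w (remove Nat.eq_dec m F) m HA) as [b Hb].
    + apply remove_In.
    + apply (same_type_trans _ A _ _ _ v).
      * apply same_type_agree; intros n Hn; apply in_remove in Hn.
        apply update_other; tauto.
      * apply (same_type_incl _ _ F); [| exact Hvw].
        intros n Hn; apply in_remove in Hn; tauto.
    + apply (IH _ _ _ Hb); [| apply Hw].
      intros n Hn; destruct (Nat.eq_dec m n) as [-> | Hmn]; [left; reflexivity | right].
      apply in_in_remove; [congruence |]; apply HF; simpl; auto.
Qed.

(** Every term contains a variable, so there is no term over [[]]. *)
Lemma same_type_nil (A B : structure) (v : nat -> A) (w : nat -> B) : same_type [] v w.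
Proof.
  assert (H : forall t, ~ over [] t).
  { induction t as [n | s IHs t _ | t IH]; intros H.
    - apply (H n); reflexivity.
    - apply IHs; intros n Hn; apply (H n); simpl; auto.
    - apply IH, H. }
  intros s t Hs; destruct (H s Hs).
Qed.

Lemma rich_model_completion (N : structure) :
  rich N -> is_model_completion T_join_closure (Th N).
Proof.
  intros HN; split; [split; [| split] | exact amalgamation].
  - intros phi [H _]; exact H.
  - apply quantifier_elimination_model_complete, rich_quantifier_elimination, HN.
  - intros phi Hs Hu; split; intros H A HA.
    + apply H, is_model_T_join_closure, (Th_model N A); [apply HN | exact HA].
    + intros v; destruct (carrier_inhabited N) as [x0].
      apply (rich_universal N A phi [] v (fun _ => x0)); [exact HN | | exact Hu | | |].
      * apply is_model_T_join_closure, HA.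
      * apply same_type_nil.
      * intros n Hn; destruct (Hs n Hn).
      * apply H; intros psi Hpsi; apply Hpsi.
Qed.

(** * Categoricity *)

Lemma isomorphism_of_types (A B : structure) (v : nat -> A) (w : nat -> B) :
  (forall a, exists t, eval A v t = a) -> (forall b, exists t, eval B w t = b) ->
  (forall s t, eval A v s = eval A v t <-> eval B w s = eval B w t) ->
  exists f : A -> B, is_isomorphism f /\ forall t, f (eval A v t) = eval B w t.
Proof.
  intros HA HB H.
  pose (tA := fun a => proj1_sig (constructive_indefinite_description _ (HA a))).
  pose (tB := fun b => proj1_sig (constructive_indefinite_description _ (HB b))).
  assert (EA : forall a, eval A v (tA a) = a)
    by (intros a; apply (proj2_sig (constructive_indefinite_description _ (HA a)))).
  assert (EB : forall b, eval B w (tB b) = b)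
    by (intros b; apply (proj2_sig (constructive_indefinite_description _ (HB b)))).
  assert (Ef : forall t, eval B w (tA (eval A v t)) = eval B w t)
    by (intros t; apply H, EA).
  exists (fun a => eval B w (tA a)); split; [split; [split; [| split] |] | exact Ef].
  - intros a a' Haa'; apply H in Haa'; rewrite !EA in Haa'; exact Haa'.
  - intros a a'; rewrite <- (EA a), <- (EA a') at 1; apply (Ef (Op (tA a) (tA a'))).
  - intros a; rewrite <- (EA a) at 1; apply (Ef (Cl (tA a))).
  - exists (fun b => eval A v (tB b)); split.
    + intros a; rewrite <- (EA a) at 2; apply H; rewrite EB; reflexivity.
    + intros b; rewrite Ef; apply EB.
Qed.

(** By quantifier elimination, the formula saying that the type of [v] on
    [m :: F] is realised over [F] depends on the type of [F] alone. *)
Lemma Th_extension (N A B : structure) (v : nat -> A) (w : nat -> B) F m :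
  rich N -> is_model (Th N) A -> is_model (Th N) B -> ~ In m F -> same_type F v w ->
  exists b, same_type (m :: F) v (update w m b).
Proof.
  intros HN HA HB Hm Hvw.
  destruct (isolating_formula A v (m :: F)) as (psi & Hq & Hf & Hv & Hw).
  destruct (rich_quantifier_elimination N HN (All m (Neg psi))) as (chi & Hcq & Hcf & H1 & H2).
  assert (Hchi : sat A v chi <-> sat B w chi).
  { apply (same_type_qf _ _ F); [exact Hvw | exact Hcq |].
    intros n Hn; destruct (Hcf n Hn) as [Hmn Hn']; simpl in Hn'.
    destruct Hn' as [Hn' | []]; destruct (Hf n Hn'); [contradiction | assumption]. }
  apply NNPP; intros Hno.
  assert (HvA : sat A v (All m (Neg psi))).
  { refine (H2 A HA v _); apply Hchi; refine (H1 B HB w _); intros b Hb; apply Hno; exists b.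
    apply Hw; [| | exact Hb]; apply (Th_model N); try apply HN; assumption. }
  specialize (HvA (v m)); rewrite update_id in HvA; exact (HvA Hv).
Qed.

(** Both structures are exhausted by one growing pair of tuples of equal type:
    the even variables enumerate [A] and the odd ones [B]. *)
Lemma Th_back_and_forth (N A B : structure) (a : nat -> A) (b : nat -> B) :
  rich N -> is_model (Th N) A -> is_model (Th N) B ->
  (forall x, exists n, a n = x) -> (forall y, exists n, b n = y) -> isomorphic A B.
Proof.
  intros HN HA HB Ha Hb.
  pose (stage := fun k => {p : (nat -> A) * (nat -> B) | same_type (seq 0 k) (fst p) (snd p)}).
  pose (good := fun k (p q : (nat -> A) * (nat -> B)) =>
    (forall i, i < k -> fst q i = fst p i /\ snd q i = snd p i) /\
    (forall n, k = 2 * n -> fst q k = a n) /\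
    (forall n, k = 2 * n + 1 -> snd q k = b n)).
  assert (Hfresh : forall k, ~ In k (seq 0 k)) by (intros k Hk; apply in_seq in Hk; lia).
  assert (Hsub : forall k, incl (seq 0 (S k)) (k :: seq 0 k)).
  { intros k i Hi; apply in_seq in Hi; simpl; rewrite in_seq; lia. }
  assert (Hupd : forall (C : structure) k (u : nat -> C) x,
    same_type (seq 0 k) (update u k x) u).
  { intros C k u x; apply same_type_agree; intros n Hn; apply update_other.
    intros ->; apply (Hfresh k Hn). }
  assert (step : forall k (p : stage k), {q : stage (S k) | good k (proj1_sig p) (proj1_sig q)}).
  { intros k [[v w] Hvw]; apply constructive_indefinite_description; simpl in Hvw.
    destruct (Nat.Even_or_Odd k) as [[n Hn] | [n Hn]].
    - destruct (Th_extension N A B (update v k (a n)) w (seq 0 k) k) as [y Hy]; auto.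
      { apply (same_type_trans _ A _ _ _ v); [apply Hupd | exact Hvw]. }
      exists (exist _ (update v k (a n), update w k y) (same_type_incl _ _ _ _ _ _ (Hsub k) Hy)).
      split; [| split]; simpl.
      + intros i Hi; rewrite !update_other by lia; auto.
      + intros n' Hn'; rewrite update_same; f_equal; lia.
      + intros n' Hn'; lia.
    - destruct (Th_extension N B A (update w k (b n)) v (seq 0 k) k) as [x Hx]; auto.
      { apply (same_type_trans _ B _ _ _ w); [apply Hupd |]; apply same_type_sym, Hvw. }
      exists (exist _ (update v k x, update w k (b n))
        (same_type_sym _ _ _ _ _ (same_type_incl _ _ _ _ _ _ (Hsub k) Hx))).
      split; [| split]; simpl.
      + intros i Hi; rewrite !update_other by lia; auto.
      + intros n' Hn'; lia.
      + intros n' Hn'; rewrite update_same; f_equal; lia. }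
  pose (st := nat_rect stage
    (exist _ (fun _ => a 0, fun _ => b 0) (same_type_nil A B (fun _ => a 0) (fun _ => b 0)))
    (fun k p => proj1_sig (step k p))).
  assert (Hst : forall k, good k (proj1_sig (st k)) (proj1_sig (st (S k))))
    by (intros k; apply (proj2_sig (step k (st k)))).
  pose (v := fun k => fst (proj1_sig (st (S k))) k).
  pose (w := fun k => snd (proj1_sig (st (S k))) k).
  assert (Hlim : forall k i, i < k ->
    fst (proj1_sig (st k)) i = v i /\ snd (proj1_sig (st k)) i = w i).
  { intros k i Hi; induction Hi as [| k Hi IH]; [split; reflexivity |].
    destruct (Hst k) as [H _]; destruct (H i Hi) as [E1 E2]; rewrite E1, E2; exact IH. }
  assert (Hvw : forall k, same_type (seq 0 k) v w).
  { intros k; apply (same_type_trans _ A _ _ _ (fst (proj1_sig (st k)))).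
    - apply same_type_agree; intros i Hi; symmetry; apply Hlim; apply in_seq in Hi; lia.
    - apply (same_type_trans _ B _ _ _ (snd (proj1_sig (st k)))); [apply (proj2_sig (st k)) |].
      apply same_type_agree; intros i Hi; apply Hlim; apply in_seq in Hi; lia. }
  destruct (isomorphism_of_types A B v w) as (f & Hf & _).
  - intros x; destruct (Ha x) as [n <-]; exists (Var (2 * n)); simpl.
    apply (Hst (2 * n)); reflexivity.
  - intros y; destruct (Hb y) as [n <-]; exists (Var (2 * n + 1)); simpl.
    apply (Hst (2 * n + 1)); reflexivity.
  - assert (Hbound : forall t, exists k, forall j, k <= j -> over (seq 0 j) t).
    { induction t as [n | s [i Hi] t [j Hj] | t [i Hi]].
      - exists (S n); intros j Hj m Hm; simpl in Hm; apply in_seq; lia.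
      - exists (max i j); intros k Hk n [Hn | Hn];
          [apply (Hi k) | apply (Hj k)]; try assumption; lia.
      - exists i; exact Hi. }
    intros s t; destruct (Hbound s) as [i Hi]; destruct (Hbound t) as [j Hj].
    apply (Hvw (max i j)); [apply Hi | apply Hj]; lia.
  - exists f; exact Hf.
Qed.

(** Each element is sent to the number of smaller codes in use. *)
Lemma infinite_countable (A : structure) :
  countable A -> (forall l : list A, exists x, ~ In x l) -> countably_infinite A.
Proof.
  intros [f Hf] Hinf.
  pose (used := fun n => exists x, f x = n).
  assert (dec : forall n, {used n} + {~ used n})
    by (intros n; apply excluded_middle_informative).
  pose (rank := fix rank n := match n with
    | 0 => 0 | S n => (if dec n then 1 else 0) + rank n end).
  assert (Hmono : forall m n, m <= n -> rank m <= rank n).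
  { intros m n Hmn; induction Hmn as [| n Hmn IH]; [lia | simpl; lia]. }
  assert (Hstep : forall x, rank (S (f x)) = S (rank (f x))).
  { intros x; simpl; destruct (dec (f x)) as [_ | H]; [reflexivity |].
    destruct H; exists x; reflexivity. }
  assert (Hlist : forall n, exists l, forall x, f x < n -> In x l).
  { induction n as [| n [l Hl]]; [exists []; intros; lia |].
    destruct (dec n) as [[y Hy] | H].
    - exists (y :: l); intros x Hx; destruct (Nat.eq_dec (f x) n) as [E | E].
      + left; apply Hf; congruence.
      + right; apply Hl; lia.
    - exists l; intros x Hx; apply Hl.
      destruct (Nat.eq_dec (f x) n) as [E | E]; [| lia].
      destruct H; exists x; exact E. }
  assert (Hunb : forall r, exists x, rank (f x) >= r).
  { induction r as [| r [x Hx]].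
    - destruct (carrier_inhabited A) as [x]; exists x; lia.
    - destruct (Hlist (S (f x))) as [l Hl]; destruct (Hinf l) as [y Hy].
      exists y.
      assert (Hxy : S (f x) <= f y)
        by (destruct (le_lt_dec (S (f x)) (f y)); [assumption | destruct Hy; auto]).
      apply Hmono in Hxy; rewrite Hstep in Hxy; lia. }
  assert (Hhit : forall n r, r < rank n -> exists x, rank (f x) = r).
  { induction n as [| n IH]; simpl; intros r Hr; [lia |].
    destruct (le_lt_dec (rank n) r) as [H | H]; [| auto].
    destruct (dec n) as [[x Hx] | _]; [| lia].
    exists x; rewrite Hx; lia. }
  assert (Hsurj : forall r, {x | rank (f x) = r}).
  { intros r; apply constructive_indefinite_description.
    destruct (Hunb r) as [x Hx]; apply (Hhit (S (f x))); rewrite Hstep; lia. }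
  assert (Hinj : forall x y, rank (f x) = rank (f y) -> x = y).
  { intros x y H; apply Hf.
    destruct (lt_eq_lt_dec (f x) (f y)) as [[Hlt | E] | Hlt]; [| exact E |];
      apply Hmono in Hlt; rewrite Hstep in Hlt; lia. }
  exists (fun x => rank (f x)), (fun r => proj1_sig (Hsurj r)).
  assert (Hg : forall r, rank (f (proj1_sig (Hsurj r))) = r)
    by (intros r; apply (proj2_sig (Hsurj r))).
  split; [intros x; apply Hinj, Hg | exact Hg].
Qed.

(** A new top element has a type that no element of a given finite list has. *)
Lemma rich_infinite (N : structure) (l : list N) : rich N -> exists x, ~ In x l.
Proof.
  intros [HN HR].
  pose (A := {|
    carrier := option N;
    op := fun x y => match x, y with Some x, Some y => Some (op x y) | _, _ => None end;
    cl := option_map cl;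
    carrier_inhabited := inhabits None
  |}).
  assert (Hs : is_embedding (A := N) (B := A) Some).
  { split; [intros x y H; congruence | split; reflexivity]. }
  assert (HA : model A).
  { destruct HN as ((As & Co & Id) & (Ex & Is & Ie)); unfold join_le in *.
    split; [split; [| split] | split; [| split]]; unfold join_le; simpl.
    - intros [x |] [y |] [z |]; try rewrite As; reflexivity.
    - intros [x |] [y |]; try rewrite Co; reflexivity.
    - intros [x |]; try rewrite Id; reflexivity.
    - intros [x |]; simpl; try rewrite Ex; reflexivity.
    - intros [x |] [y |]; simpl; try reflexivity; [| discriminate].
      intros H; injection H as H; rewrite (Is x y H); reflexivity.
    - intros [x |]; simpl; try rewrite Ie; reflexivity. }
  destruct (carrier_inhabited N) as [x0].
  pose (w := fun n => nth n l x0); pose (k := length l).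
  assert (Hk : ~ In k (seq 0 k)) by (intros H; apply in_seq in H; lia).
  destruct (HR A (update (fun n => Some (w n)) k None : nat -> A) w (seq 0 k) k HA Hk) as [b Hb].
  { apply (same_type_trans _ A _ _ _ (fun n => Some (w n))).
    - apply same_type_agree; intros n Hn.
      apply (update_other (fun n => Some (w n)) k n None).
      intros E; rewrite E in Hn; exact (Hk Hn).
    - apply same_type_sym, (same_type_embedding N A Some), Hs. }
  exists b; intros Hin; destruct (In_nth l b x0 Hin) as (n & Hn & Hnb).
  specialize (Hb (Var n) (Var k)); simpl in Hb.
  rewrite !update_same, !update_other in Hb by (unfold k; lia).
  enough (Some (w n) = None) by discriminate.
  apply Hb; [| | exact Hnb]; intros m Hm; simpl in Hm; subst m; simpl; auto.
  right; apply in_seq; unfold k; lia.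
Qed.

Lemma rich_omega_categorical (N : structure) :
  rich N -> countable N -> omega_categorical (Th N).
Proof.
  intros HN HC; split.
  - exists N; split; [intros phi [_ H]; exact H |].
    apply infinite_countable; [exact HC |]; intros l; apply rich_infinite, HN.
  - intros A B HA [f [a [Ha _]]] HB [g [b [Hb _]]].
    apply (Th_back_and_forth N A B a b HN HA HB).
    + intros x; exists (f x); apply Ha.
    + intros y; exists (g y); apply Hb.
Qed.

(** * Fraïssé limits *)

(** The substructure generated by the range of [w]. *)
Definition values (A : structure) (w : nat -> A) : substructure A := {|
  dom := fun x => exists t, eval A w t = x;
  dom_nonempty := ex_intro _ (w 0) (ex_intro _ (Var 0) eq_refl);
  dom_op := fun x y Hx Hy =>
    let (s, Hs) := Hx in let (t, Ht) := Hy in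
    ex_intro _ (Op s t) (f_equal2 op Hs Ht);
  dom_cl := fun x Hx => let (t, Ht) := Hx in ex_intro _ (Cl t) (f_equal cl Ht)
|}.

Definition gens (A : structure) (w : nat -> A) (n : nat) : induced (values A w) :=
  exist _ (w n) (ex_intro _ (Var n) eq_refl).

Lemma eval_gens (A : structure) (w : nat -> A) t :
  proj1_sig (eval (induced (values A w)) (gens A w) t) = eval A w t.
Proof.
  exact (eval_hom (induced (values A w)) A (@proj1_sig _ _) (gens A w) t
    (embedding_hom _ _ _ (induced_embedding A (values A w)))).
Qed.

Lemma gens_generate (A : structure) (w : nat -> A) (x : induced (values A w)) :
  exists t, eval (induced (values A w)) (gens A w) t = x.
Proof.
  destruct x as [x [t Ht]]; exists t.
  apply (proj1 (induced_embedding A (values A w))); rewrite eval_gens; exact Ht.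
Qed.

Lemma values_finitely_generated (A : structure) (w : nat -> A) F :
  (forall n, exists m, In m F /\ w n = w m) -> finitely_generated (induced (values A w)).
Proof.
  intros HF; exists (map (gens A w) F); intros x.
  destruct (gens_generate A w x) as [t <-].
  induction t as [n | s IHs t IHt | t IHt].
  - apply gen_base; simpl; apply in_map_iff.
    destruct (HF n) as (m & Hm & Hnm); exists m; split; [| exact Hm].
    apply (proj1 (induced_embedding A (values A w))); symmetry; exact Hnm.
  - apply gen_op; assumption.
  - apply gen_cl; assumption.
Qed.

Lemma values_finite (A : structure) (w : nat -> A) F :
  model A -> (forall n, exists m, In m F /\ w n = w m) -> Finite (induced (values A w)).
Proof.
  intros HA HF.
  pose (r := fun n => proj1_sig (constructive_indefinite_description _ (HF n))).
  assert (Hr : forall n, In (r n) F /\ w n = w (r n))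
    by (intros n; apply (proj2_sig (constructive_indefinite_description _ (HF n)))).
  assert (HS : model (induced (values A w)))
    by exact (embedded_model _ _ _ (induced_embedding A _) HA).
  exists (map (eval _ (gens A w)) (normal_terms F)); intros x.
  destruct (gens_generate A w x) as [t <-].
  destruct (normal_form F (rename r t)) as (t' & Ht' & E).
  { apply over_rename; intros n; apply Hr. }
  apply in_map_iff; exists t'; split; [| exact Ht'].
  rewrite <- (E _ _ HS), eval_rename; apply eval_agree.
  intros n _; apply (proj1 (induced_embedding A (values A w))); symmetry; apply Hr.
Qed.

(** Redirects the variables outside [p :: F] to [p], so that a type over
    finitely many variables becomes the type of a whole valuation with finite
    range. *)
Definition redirect (p : nat) (F : list nat) (n : nat) : nat :=
  if in_dec Nat.eq_dec n (p :: F) then n else p.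

Lemma redirect_in p F n : In (redirect p F n) (p :: F).
Proof. unfold redirect; destruct (in_dec _ _ _); simpl; auto. Qed.

Lemma redirect_id p F n : In n (p :: F) -> redirect p F n = n.
Proof. unfold redirect; destruct (in_dec _ _ _); tauto. Qed.

Lemma redirect_finite_range {X : Type} (w : nat -> X) p F n :
  exists m, In m (p :: F) /\ w (redirect p F n) = w (redirect p F m).
Proof.
  exists (redirect p F n); split; [apply redirect_in |].
  rewrite (redirect_id p F (redirect p F n)); [reflexivity | apply redirect_in].
Qed.

Section FraisseLimit.

Context (M : structure) (HM : is_Fraisse_limit finite_join_semilattice_with_closure M).

(** The axioms involve at most three elements, which generate a substructure in
    the age. *)
Lemma fraisse_model : model M.
Proof.
  destruct HM as (_ & _ & HA).
  assert (Hsub : forall x y z : M, exists (S : structure) (f : S -> M) (x' y' z' : S),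
    model S /\ is_embedding f /\ f x' = x /\ f y' = y /\ f z' = z).
  { intros x y z.
    pose (w := fun n => match n with 0 => x | 1 => y | _ => z end).
    exists (induced (values M w)), (@proj1_sig _ _), (gens M w 0), (gens M w 1), (gens M w 2).
    split; [| split; [apply induced_embedding | auto]].
    apply HA; split.
    - apply (values_finitely_generated M w [0; 1; 2]).
      intros [| [| n]]; [exists 0 | exists 1 | exists 2]; simpl; auto.
    - exists (@proj1_sig _ _); apply induced_embedding. }
  split; [split; [| split] | split; [| split]]; unfold join_le.
  - intros x y z.
    destruct (Hsub x y z) as (S & f & x' & y' & z' & [(As & _) _] & (_ & Hop & _) & <- & <- & <-).
    rewrite <- !Hop, As; reflexivity.
  - intros x y.
    destruct (Hsub x y y) as (S & f & x' & y' & z' & [(_ & Co & _) _] & (_ & Hop & _) & <- & <- & _).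
    rewrite <- !Hop, Co; reflexivity.
  - intros x.
    destruct (Hsub x x x) as (S & f & x' & y' & z' & [(_ & _ & Id) _] & (_ & Hop & _) & <- & _ & _).
    rewrite <- !Hop, Id; reflexivity.
  - intros x.
    destruct (Hsub x x x) as (S & f & x' & y' & z' & [_ (Ex & _)] & (_ & Hop & Hcl) & <- & _ & _).
    rewrite <- Hcl, <- !Hop, Ex; reflexivity.
  - intros x y.
    destruct (Hsub x y y) as (S & f & x' & y' & z' & [_ (_ & Is & _)] & (Hi & Hop & Hcl) & <- & <- & _).
    intros H; rewrite <- Hop in H; apply Hi in H.
    rewrite <- !Hcl, <- !Hop, (Is _ _ H); reflexivity.
  - intros x.
    destruct (Hsub x x x) as (S & f & x' & y' & z' & [_ (_ & _ & Ie)] & (_ & Hop & Hcl) & <- & _ & _).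
    rewrite <- !Hcl, Ie; reflexivity.
Qed.

(** The submodel of [A] generated by the tuple is finite, so universality embeds
    it in [M]. *)
Lemma fraisse_realises (A : structure) (v : nat -> A) p F :
  model A -> exists u : nat -> M, same_type (p :: F) v u.
Proof.
  intros HA; destruct HM as (_ & _ & Hage).
  pose (v' := fun n => v (redirect p F n)).
  assert (HS : age M (induced (values A v'))).
  { apply Hage; split.
    - apply (values_finite A v' (p :: F) HA (redirect_finite_range v p F)).
    - exact (embedded_model _ _ _ (induced_embedding A _) HA). }
  destruct HS as [_ [h Hh]].
  exists (fun n => h (gens A v' n)).
  apply (same_type_trans _ A _ _ _ v').
  - apply same_type_agree; intros n Hn; unfold v'; rewrite redirect_id; auto.
  - apply (same_type_trans _ (induced (values A v')) _ _ _ (gens A v')).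
    + apply same_type_sym, (same_type_embedding _ _ _ _ (gens A v') (induced_embedding A (values A v'))).
    + apply same_type_embedding, Hh.
Qed.

(** Equality of types says that sending [u n] to [w n] extends to an isomorphism
    between the generated substructures, to which homogeneity applies. *)
Lemma fraisse_automorphism (u w : nat -> M) F :
  same_type F u w ->
  exists g : M -> M, is_embedding g /\ forall n, In n F -> g (u n) = w n.
Proof.
  intros Huw; destruct F as [| p F].
  - exists (fun x => x); split; [| intros n []].
    split; [intros x y H; exact H | split; reflexivity].
  - destruct HM as (_ & Hhom & _).
    pose (u' := fun n => u (redirect p F n)); pose (w' := fun n => w (redirect p F n)).
    destruct (isomorphism_of_types (induced (values M u')) (induced (values M w'))
      (gens M u') (gens M w')) as (f & Hf & Ef).
    + apply gens_generate.
    + apply gens_generate.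
    + intros s t.
      pose proof (proj1 (induced_embedding M (values M u'))) as Iu.
      pose proof (proj1 (induced_embedding M (values M w'))) as Iw.
      transitivity (eval M u' s = eval M u' t); [| transitivity (eval M w' s = eval M w' t)].
      * rewrite <- (eval_gens M u' s), <- (eval_gens M u' t).
        split; [congruence | apply Iu].
      * pose proof (Huw (rename (redirect p F) s) (rename (redirect p F) t)) as E.
        rewrite !eval_rename in E; apply E; apply over_rename, redirect_in.
      * rewrite <- (eval_gens M w' s), <- (eval_gens M w' t).
        split; [apply Iw | congruence].
    + destruct (Hhom (values M u') (values M w')
        (values_finitely_generated M u' _ (redirect_finite_range u p F))
        (values_finitely_generated M w' _ (redirect_finite_range w p F)) f Hf)
        as (g & [Hg _] & Hgf).
      exists g; split; [exact Hg |]; intros n Hn.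
      pose proof (Hgf (gens M u' n)) as E.
      change (gens M u' n) with (eval _ (gens M u') (Var n)) in E at 2.
      rewrite Ef in E; simpl in E; unfold u', w' in E.
      rewrite (redirect_id p F n Hn) in E; exact E.
Qed.

Lemma fraisse_rich : rich M.
Proof.
  split; [exact fraisse_model |].
  intros A v w F m HA Hm Hvw.
  destruct (fraisse_realises A v m F HA) as [u Hu].
  destruct (fraisse_automorphism u w F) as (g & Hg & Egw).
  { apply (same_type_trans _ A _ _ _ v); [| exact Hvw].
    apply same_type_sym, (same_type_incl _ _ (m :: F)); [| exact Hu].
    intros n Hn; right; exact Hn. }
  exists (g (u m)).
  apply (same_type_trans _ M _ _ _ u); [exact Hu |].
  apply (same_type_trans _ M _ _ _ (fun n => g (u n))); [apply same_type_embedding, Hg |].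
  apply same_type_agree; intros n [<- | Hn]; [rewrite update_same; reflexivity |].
  rewrite update_other by congruence; apply Egw, Hn.
Qed.

Lemma fraisse_limit_theory :
  omega_categorical (Th M) /\ has_quantifier_elimination (Th M) /\
  is_model_completion T_join_closure (Th M).
Proof.
  pose proof fraisse_rich as HR.
  split; [| split].
  - apply rich_omega_categorical; [exact HR | apply HM].
  - apply rich_quantifier_elimination, HR.
  - apply rich_model_completion, HR.
Qed.

End FraisseLimit.

(** * Duality *)

(** As [op] is commutative, [op x y = x] is [op y x = x], so that the meet order
    is the reverse of the join order of the same structure. *)
Lemma meet_interior_iff_join_closure (A : structure) :
  meet_semilattice_with_interior A <-> join_semilattice_with_closure A.
Proof.
  unfold meet_semilattice_with_interior, join_semilattice_with_closure,
    is_interior, is_closure, meet_le, join_le.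
  split; intros ((As & Co & Id) & (Ex & Is & Ie));
    (split; [split; [| split]; assumption | split; [| split; [| exact Ie]]]).
  - intros x; rewrite Co; apply Ex.
  - intros x y; rewrite (Co x), (Co (cl x)); apply Is.
  - intros x; rewrite Co; apply Ex.
  - intros x y; rewrite (Co x), (Co (cl x)); apply Is.
Qed.

Lemma is_model_completion_ext (T T' U : formula -> Prop) :
  (forall A, is_model T A <-> is_model T' A) ->
  is_model_completion T U -> is_model_completion T' U.
Proof.
  intros H ((HU & HC & Hun) & Ham); split; [split; [exact HU | split; [exact HC |]] |].
  - intros phi Hs Hphi; rewrite <- (Hun phi Hs Hphi).
    split; intros He A HA; apply He, H, HA.
  - intros A B C f g HA HB HC' Hf Hg; rewrite <- H in HA, HB, HC'.
    destruct (Ham A B C f g HA HB HC' Hf Hg) as (D & f' & g' & HD & Hrest).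
    exists D, f', g'; split; [apply H, HD | exact Hrest].
Qed.

Theorem corollary4p6 :
  (has_model_completion T_join_closure /\
   forall M : structure,
     is_Fraisse_limit finite_join_semilattice_with_closure M ->
     omega_categorical (Th M) /\
     has_quantifier_elimination (Th M) /\
     is_model_completion T_join_closure (Th M)) /\
  (has_model_completion T_meet_interior /\
   forall M : structure,
     is_Fraisse_limit finite_meet_semilattice_with_interior M ->
     omega_categorical (Th M) /\
     has_quantifier_elimination (Th M) /\
     is_model_completion T_meet_interior (Th M)).
Proof.
  assert (Hmodels : forall A, is_model T_join_closure A <-> is_model T_meet_interior A).
  { intros A; rewrite is_model_T_join_closure, is_model_T_meet_interior.
    symmetry; apply meet_interior_iff_join_closure. }
  destruct rich_model_exists as [N HN].
  split; split.
  - exists (Th N); apply rich_model_completion, HN.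
  - exact fraisse_limit_theory.
  - exists (Th N); apply (is_model_completion_ext _ _ _ Hmodels), rich_model_completion, HN.
  - intros M (Hc & Hh & Ha).
    assert (HM : is_Fraisse_limit finite_join_semilattice_with_closure M).
    { split; [exact Hc | split; [exact Hh |]]; intros A; rewrite <- Ha.
      unfold finite_join_semilattice_with_closure, finite_meet_semilattice_with_interior.
      rewrite meet_interior_iff_join_closure; reflexivity. }
    destruct (fraisse_limit_theory M HM) as (H1 & H2 & H3).
    split; [exact H1 | split; [exact H2 |]].
    apply (is_model_completion_ext _ _ _ Hmodels), H3.
Qed.
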